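(* Let $m \geq 1$ be a positive integer and let $k$ be an algebraically closed field of characteristic zero. There exists a cosemisimple Hopf algebra over $k$ whose antipode has order exactly $2m$.
   Context: The order of the antipode $S$ is the smallest positive integer $N$ with $S^N = \mathrm{id}$. A Hopf algebra is cosemisimple if its category of comodules is semisimple (every comodule is a direct sum of simple comodules). *)

(* Defs.v *)
(* Hopf algebras, comodules and cosemisimplicity over a field,
   built from scratch (MathComp has no tensor products).
   An element of a tensor product U (x) V (resp. U (x) V (x) W) of k-vector
   spaces is represented by a finite list of elementary tensors, i.e. a
   [seq (U * V)] standing for  sum_i u_i (x) v_i.  Two such lists represent the
   same tensor iff they agree under every bilinear (resp. trilinear) form into
   k (linear functionals separate the points of a vector space, and linear
   functionals on U (x) V are exactly the bilinear forms on U x V). *)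
From HB Require Import structures.
From mathcomp Require Import all_boot all_order all_algebra.
Set Implicit Arguments. Unset Strict Implicit. Unset Printing Implicit Defensive.
Import Order.TTheory GRing.Theory Num.Theory.
Local Open Scope ring_scope.

Definition bilinear_form (k : fieldType) (U V : lmodType k) (f : U -> V -> k)
  : Prop :=
  (forall u a v1 v2, f u (a *: v1 + v2) = a * f u v1 + f u v2) /\
  (forall v a u1 u2, f (a *: u1 + u2) v = a * f u1 v + f u2 v).

Definition trilinear_form (k : fieldType) (U V W : lmodType k)
  (f : U -> V -> W -> k) : Prop :=
  (forall v w a u1 u2, f (a *: u1 + u2) v w = a * f u1 v w + f u2 v w) /\
  (forall u w a v1 v2, f u (a *: v1 + v2) w = a * f u v1 w + f u v2 w) /\
  (forall u v a w1 w2, f u v (a *: w1 + w2) = a * f u v w1 + f u v w2).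

Definition teq2 (k : fieldType) (U V : lmodType k) (s t : seq (U * V)) : Prop :=
  forall f : U -> V -> k, bilinear_form f ->
    \sum_(p <- s) f p.1 p.2 = \sum_(p <- t) f p.1 p.2.

Definition teq3 (k : fieldType) (U V W : lmodType k)
  (s t : seq (U * V * W)) : Prop :=
  forall f : U -> V -> W -> k, trilinear_form f ->
    \sum_(p <- s) f p.1.1 p.1.2 p.2 = \sum_(p <- t) f p.1.1 p.1.2 p.2.

Record hopf_data (k : fieldType) (H : algType k) := HopfData {
  comul : H -> seq (H * H);
  counit : H -> k;
  antipode : H -> H }.

Record is_hopf (k : fieldType) (H : algType k) (D : hopf_data H) : Prop := {
  comul_linear : forall a (x y : H),
    teq2 (comul D (a *: x + y))
         ([seq (a *: p.1, p.2) | p <- comul D x] ++ comul D y);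
  comul_coassoc : forall h : H,
    teq3 [seq (q.1, q.2, p.2) | p <- comul D h, q <- comul D p.1]
         [seq (p.1, q.1, q.2) | p <- comul D h, q <- comul D p.2];
  counit_linear : forall a (x y : H),
    counit D (a *: x + y) = a * counit D x + counit D y;
  counit_left : forall h : H, \sum_(p <- comul D h) counit D p.1 *: p.2 = h;
  counit_right : forall h : H, \sum_(p <- comul D h) counit D p.2 *: p.1 = h;
  comul_one : teq2 (comul D 1) [:: (1, 1)];
  comul_mul : forall x y : H,
    teq2 (comul D (x * y))
         [seq (p.1 * q.1, p.2 * q.2) | p <- comul D x, q <- comul D y];
  counit_one : counit D 1 = 1;
  counit_mul : forall x y : H, counit D (x * y) = counit D x * counit D y;
  antipode_linear : forall a (x y : H),
    antipode D (a *: x + y) = a *: antipode D x + antipode D y;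
  antipode_left : forall h : H,
    \sum_(p <- comul D h) antipode D p.1 * p.2 = counit D h *: 1;
  antipode_right : forall h : H,
    \sum_(p <- comul D h) p.1 * antipode D p.2 = counit D h *: 1 }.

Definition antipode_order_is (k : fieldType) (H : algType k) (D : hopf_data H)
  (N : nat) : Prop :=
  (0 < N)%N /\ (forall h, iter N (antipode D) h = h) /\
  (forall n, (0 < n < N)%N -> ~ (forall h, iter n (antipode D) h = h)).

Record is_comodule (k : fieldType) (H : algType k) (D : hopf_data H)
  (V : lmodType k) (rho : V -> seq (V * H)) : Prop := {
  coact_linear : forall a (x y : V),
    teq2 (rho (a *: x + y)) ([seq (a *: p.1, p.2) | p <- rho x] ++ rho y);
  coact_coassoc : forall v : V,
    teq3 [seq (q.1, q.2, p.2) | p <- rho v, q <- rho p.1]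
         [seq (p.1, q.1, q.2) | p <- rho v, q <- comul D p.2];
  coact_counit : forall v : V, \sum_(p <- rho v) counit D p.2 *: p.1 = v }.

Definition subcomodule (k : fieldType) (H : algType k) (V : lmodType k)
  (rho : V -> seq (V * H)) (W : V -> Prop) : Prop :=
  W 0 /\ (forall a x y, W x -> W y -> W (a *: x + y)) /\
  (forall w, W w -> exists t : seq (V * H),
     teq2 (rho w) t /\ (forall p, p \in t -> W p.1)).

Definition simple_subcomodule (k : fieldType) (H : algType k) (V : lmodType k)
  (rho : V -> seq (V * H)) (W : V -> Prop) : Prop :=
  subcomodule rho W /\ (exists w, W w /\ w <> 0) /\
  (forall U : V -> Prop, subcomodule rho U -> (forall u, U u -> W u) ->
     (forall u, U u -> u = 0) \/ (forall w, W w -> U w)).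

Definition direct_sum_of_simples (k : fieldType) (H : algType k)
  (V : lmodType k) (rho : V -> seq (V * H)) : Prop :=
  exists (I : Type) (W : I -> V -> Prop),
    (forall i, simple_subcomodule rho (W i)) /\
    (forall v : V, exists (n : nat) (idx : 'I_n -> I) (ws : 'I_n -> V),
        injective idx /\ (forall j, W (idx j) (ws j)) /\ v = \sum_j ws j) /\
    (forall (n : nat) (idx : 'I_n -> I) (ws : 'I_n -> V),
        injective idx -> (forall j, W (idx j) (ws j)) -> \sum_j ws j = 0 ->
        forall j, ws j = 0).

Definition cosemisimple (k : fieldType) (H : algType k) (D : hopf_data H)
  : Prop :=
  forall (V : lmodType k) (rho : V -> seq (V * H)),
    is_comodule D rho -> direct_sum_of_simples rho.

(* Main.v *)
Require Import Defs.
From HB Require Import structures.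
From mathcomp Require Import all_boot all_order all_algebra all_field.
From mathcomp Require Import generic_quotient cyclic ring.
From mathcomp Require Import boolp classical_sets functions.
Set Implicit Arguments. Unset Strict Implicit. Unset Printing Implicit Defensive.
Import GRing.Theory.
Local Open Scope ring_scope.

(** The Hopf algebra is the Dubois-Violette--Launer algebra of a nondegenerate
    bilinear form [E]: it is generated by the entries of a matrix [x] with
    [x E x^T = E] and [x^T E^-1 x = E^-1], and [S^2] conjugates [x] by the
    asymmetry [E^T E^-1] (up to convention).  We take [E] pairing the basis
    vector [a] with [s a] only, with value [c a], where [s] is an involution;
    then [S^2 x_ij = (q_i / q_j) x_ij] with [q_a = c a / c (s a)], and roots of
    unity can be prescribed for [q].

    The category of comodules is governed by the Temperley-Lieb algebra with loop
    value [\sum_a q_a], which we arrange to be [2]: in characteristic zero all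
    Jones-Wenzl idempotents then exist.  They yield, by recursion on [n], the
    projection of the [n]-th tensor power on its invariants, whose entries are the
    values of a Haar integral; averaging against it splits every subcomodule. *)

(** * Vector spaces of arbitrary dimension *)

(** For [m > 1] the example has to be infinite-dimensional: in characteristic zero a
    finite-dimensional cosemisimple Hopf algebra has an involutive antipode. This is why the linear
    algebra works in arbitrary dimension, with Zorn's lemma in place of bases, and why
    cosemisimplicity is derived from a single normalised invariant functional. The same functional
    shows that the relations do not kill the generators, so that the prescribed eigenvalues of [S^2]
    are attained.

    The algebra is handled through its dual. A functional on it is a function on words that respects
    the relations, and two elements are equal when all these functions agree on them. A structure
    map is defined on words, and its compatibility with the relations becomes the statement that
    pulling back along it preserves these functions.

    Odd powers of [S] reverse products and are not diagonal on words. They are excluded separately: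
    [s] has a point that it moves, and a character of the algebra distinguishes the two
    corresponding diagonal generators. *)

Section Zorn.
Local Open Scope classical_set_scope.

Lemma zorn_above (T : Type) (P : set (set T)) (U : set T) :
  P U ->
  (forall F, F `<=` P -> total_on F subset -> F !=set0 ->
     P (\bigcup_(X in F) X)) ->
  exists A, [/\ U `<=` A, P A & forall B, A `<=` B -> P B -> B `<=` A].
Proof.
move=> PU chainP.
(* The empty chain has empty union, which may fail [P]; enlarging every set by [U] turns this case
   into [P U]. *)
have [|A [PA maxA]] := @Zorn_bigcup T (fun X => P (U `|` X)).
  move=> F FP Ftot; have [->|/set0P[X0 FX0]] := eqVneq F set0.
    by rewrite bigcup_set0 setU0.
  have -> : U `|` \bigcup_(X in F) X = \bigcup_(X in [set U `|` Y | Y in F]) X.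
    apply/seteqP; split=> x /=.
      case=> [Ux|[X FX Xx]]; first by exists (U `|` X0); [exists X0|left].
      by exists (U `|` X); [exists X|right].
    by case=> _ [X FX <-] [Ux|Xx]; [left|right; exists X].
  apply: chainP.
  - by move=> _ [X FX <-]; exact: FP.
  - move=> _ _ [X FX <-] [Y FY <-].
    by case: (Ftot X Y FX FY) => XY; [left|right]; apply: setUS.
  - by exists (U `|` X0), X0.
exists (U `|` A); split=> [x Ux|//|B UAB PB]; first by left.
apply: contrapT => nBA; apply: (maxA B).
  split; first by move=> x Ax; apply: UAB; right.
  by move=> BA; apply: nBA => x /BA; right.
rewrite (_ : U `|` B = B) //; apply/seteqP; split=> x; last by right.
by case=> // Ux; apply: UAB; left.
Qed.

End Zorn.

Section LinearAlgebra.
Variable k : fieldType.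
Implicit Types V X : lmodType k.

Definition subspace V (W : V -> Prop) : Prop :=
  W 0 /\ forall a x y, W x -> W y -> W (a *: x + y).

Section LinearMaps.
Variables (V X : lmodType k) (f : V -> X).
Hypothesis lin_f : linear f.

Lemma linear_map0 : f 0 = 0.
Proof. by have := lin_f (-1) 0 0; rewrite !scaleN1r oppr0 addr0 addNr. Qed.

Lemma linear_mapD : {morph f : x y / x + y}.
Proof. by move=> x y; have := lin_f 1 x y; rewrite !scale1r. Qed.

Lemma linear_mapZ a x : f (a *: x) = a *: f x.
Proof. by have := lin_f a x 0; rewrite !addr0 linear_map0 addr0. Qed.

Lemma linear_mapB : {morph f : x y / x - y}.
Proof. by move=> x y; rewrite linear_mapD -scaleN1r linear_mapZ scaleN1r. Qed.

Lemma linear_map_sum (J : Type) (r : seq J) (F : J -> V) :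
  f (\sum_(j <- r) F j) = \sum_(j <- r) f (F j).
Proof. exact: (big_morph f linear_mapD linear_map0). Qed.

End LinearMaps.

Lemma scalar_linear V (L : V -> k) : scalar L -> linear (L : V -> k^o).
Proof. by []. Qed.

Section Subspaces.
Variables (V : lmodType k) (W : V -> Prop).
Hypothesis sub_W : subspace W.

Lemma subspace0 : W 0. Proof. by case: sub_W. Qed.

Lemma subspaceD x y : W x -> W y -> W (x + y).
Proof. by move=> Wx Wy; rewrite -[x]scale1r; apply: sub_W.2. Qed.

Lemma subspaceZ a x : W x -> W (a *: x).
Proof. by move=> Wx; rewrite -[_ *: _]addr0; apply: sub_W.2 => //; apply: sub_W.1. Qed.

Lemma subspaceB x y : W x -> W y -> W (x - y).
Proof. by move=> Wx Wy; apply: subspaceD => //; rewrite -scaleN1r; apply: subspaceZ. Qed.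

Lemma subspace_sum (J : Type) (r : seq J) (F : J -> V) :
  (forall j, W (F j)) -> W (\sum_(j <- r) F j).
Proof.
by move=> WF; apply: (big_ind W) => //; [exact: subspace0|exact: subspaceD].
Qed.

Lemma subspace_sum_in (J : eqType) (r : seq J) (F : J -> V) :
  (forall j, j \in r -> W (F j)) -> W (\sum_(j <- r) F j).
Proof.
move=> WF; rewrite big_seq_cond; apply: (big_ind W).
- exact: subspace0.
- exact: subspaceD.
- by move=> j; rewrite andbT; apply: WF.
Qed.

End Subspaces.

Lemma linear_projection V (U : V -> Prop) : subspace U ->
  exists p : V -> V,
    [/\ linear p, forall x, U (p x) & forall x, U x -> p x = x].
Proof.
move=> sU.
pose P (M : set V) := subspace M /\ forall x, M x -> U x -> x = 0.
have [||M [_ [sM MU] maxM]] := @zorn_above V P (fun x => x = 0).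
- split=> //; split=> // a x y -> ->; by rewrite scaler0 addr0.
- move=> F FP Ftot [X0 FX0]; split; last first.
    by move=> x [X FX Xx]; apply: (FP X FX).2.
  split; first by exists X0 => //; apply: (FP X0 FX0).1.1.
  move=> a x y [X FX Xx] [Y FY Yy].
  case: (Ftot X Y FX FY) => XY; first by exists Y => //; apply: (FP Y FY).1.2; auto.
  by exists X => //; apply: (FP X FX).1.2; auto.
(* If [x] were outside [U + M], adjoining it to [M] would still meet [U] only in 0, since a vector
   [a *: x + m] of [U] with [a != 0] yields a decomposition of [x]. Maximality would then put [x] in
   [M]. *)
have dec x : exists u, U u /\ M (x - u).
  apply: contrapT => nx; pose B y := exists a m, M m /\ y = a *: x + m.
  have BM : forall y, B y -> M y.
    apply: maxM; first by move=> y My; exists 0, y; rewrite scale0r add0r.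
    split.
      split; first by exists 0, 0; rewrite scale0r addr0; split=> //; apply: sM.1.
      move=> b _ _ [a [m [Mm ->]]] [a' [m' [Mm' ->]]].
      exists (b * a + a'), (b *: m + m'); split; first exact: sM.2.
      by rewrite scalerDr scalerA scalerDl addrACA.
    move=> _ [a [m [Mm ->]]] Uy.
    have [a0|a0] := eqVneq a 0.
      by move: Uy; rewrite a0 scale0r add0r => Uy; apply: MU.
    case: nx; exists (a^-1 *: (a *: x + m)); split; first exact: subspaceZ.
    rewrite scalerDr scalerA mulVf // scale1r opprD addrA subrr add0r -scaleNr.
    exact: subspaceZ.
  apply: nx; exists 0; split; first exact: subspace0.
  rewrite subr0; apply: BM; exists 1, 0; rewrite scale1r addr0.
  by split=> //; apply: sM.1.
have /choice [p pP] := dec.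
exists p; split=> [a x y|x|x Ux]; try by case: (pP x).
  apply/eqP; rewrite -subr_eq0; apply/eqP/MU.
    have -> : p (a *: x + y) - (a *: p x + p y) =
      (a *: (x - p x) + (y - p y)) - (a *: x + y - p (a *: x + y)).
      by rewrite scalerBr addrACA -opprD opprB [RHS]addrC addrA subrK.
    by apply: subspaceB => //; [apply: sM.2|]; apply: (pP _).2.
  by apply: subspaceB => //; [|apply: sU.2]; apply: (pP _).1.
apply/eqP; rewrite eq_sym -subr_eq0; apply/eqP/MU; first by case: (pP x).
by apply: subspaceB => //; case: (pP x).
Qed.

Lemma separating_functional V (U : V -> Prop) (v : V) :
  subspace U -> ~ U v ->
  exists L : V -> k, [/\ scalar L, forall u, U u -> L u = 0 & L v = 1].
Proof.
move=> sU Uv; have [p [lin_p pU pid]] := linear_projection sU.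
set v' := v - p v.
have v'0 : v' != 0.
  by apply/eqP => /eqP; rewrite subr_eq0 => /eqP vE; apply: Uv; rewrite vE.
have [|q [lin_q qv qid]] := @linear_projection V (fun x => exists a, x = a *: v').
  split; first by exists 0; rewrite scale0r.
  by move=> b _ _ [a ->] [a' ->]; exists (b * a + a'); rewrite scalerDl scalerA.
have /choice [l lP] := qv.
have linj a b : a *: v' = b *: v' -> a = b.
  move/eqP; rewrite -subr_eq0 -scalerBl scaler_eq0 (negPf v'0) orbF subr_eq0.
  by move/eqP.
exists (fun x => l (x - p x)); split=> [a x y|u Uu|].
- apply: linj; rewrite -lP scalerDl -scalerA -!lP -lin_q lin_p.
  by congr q; rewrite scalerBr addrACA -opprD.
- by apply: linj; rewrite -lP pid // subrr scale0r (linear_map0 lin_q).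
- by apply: linj; rewrite -lP scale1r qid //; exists 1; rewrite scale1r.
Qed.

Lemma functionals_separate V (x y : V) :
  (forall L : V -> k, scalar L -> L x = L y) -> x = y.
Proof.
move=> Lxy; apply/eqP; rewrite -subr_eq0; apply/eqP; apply: contrapT => nxy.
have [|L [lin_L _ Lx]] := @separating_functional V (fun x => x = 0) (x - y) _ nxy.
  by split=> // a u v -> ->; rewrite scaler0 addr0.
move: Lx; rewrite (linear_mapB (scalar_linear lin_L)) Lxy // subrr.
by move/esym/eqP; rewrite oner_eq0.
Qed.

Definition bilinear_map (U V X : lmodType k) (g : U -> V -> X) : Prop :=
  (forall u, linear (g u)) /\ (forall v, linear (g^~ v)).

Definition trilinear_map (U V W X : lmodType k) (g : U -> V -> W -> X) : Prop :=
  [/\ forall v w, linear (fun u => g u v w),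
      forall u w, linear (fun v => g u v w) &
      forall u v, linear (fun w => g u v w)].

(** Functionals separate points, so the scalar forms tested by [teq2] already control bilinear maps
    with values in any space. *)
Lemma teq2_bilinear (U V X : lmodType k) (g : U -> V -> X) s t :
  bilinear_map g -> teq2 s t ->
  \sum_(p <- s) g p.1 p.2 = \sum_(p <- t) g p.1 p.2.
Proof.
move=> [g1 g2] st; apply: functionals_separate => L /[dup] lin_L /scalar_linear lL.
rewrite !(linear_map_sum lL); apply: (st (fun u v => L (g u v))).
by split=> [u a x y|v a x y]; rewrite ?g1 ?g2 lin_L.
Qed.

Lemma teq3_trilinear (U V W X : lmodType k) (g : U -> V -> W -> X) s t :
  trilinear_map g -> teq3 s t ->
  \sum_(p <- s) g p.1.1 p.1.2 p.2 = \sum_(p <- t) g p.1.1 p.1.2 p.2.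
Proof.
move=> [g1 g2 g3] st; apply: functionals_separate => L /[dup] lin_L /scalar_linear lL.
rewrite !(linear_map_sum lL); apply: (st (fun u v w => L (g u v w))).
by split; [|split] => u v a x y; rewrite ?g1 ?g2 ?g3 lin_L.
Qed.

Fixpoint span V (r : seq V) (x : V) : Prop :=
  if r is h :: r' then exists a y, x = a *: h + y /\ span r' y else x = 0.

Lemma span_subspace V (r : seq V) : subspace (span r).
Proof.
elim: r => [|h r [r0 rD]].
  by split=> // a x y -> ->; rewrite scaler0 addr0.
split; first by exists 0, 0; rewrite scale0r addr0.
move=> b _ _ [a [x [-> rx]]] [a' [x' [-> rx']]].
exists (b * a + a'), (b *: x + x'); split; last exact: rD.
by rewrite scalerDr scalerA scalerDl addrACA.
Qed.

Lemma mem_span V (r : seq V) x : x \in r -> span r x.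
Proof.
elim: r => // h r IHr; rewrite inE => /predU1P[->|xr].
  by exists 1, 0; rewrite scale1r addr0; split=> //; apply: (span_subspace r).1.
by exists 0, x; rewrite scale0r add0r; split=> //; apply: IHr.
Qed.

(** If [h = \sum_i a_i h_i], then [v (x) h + \sum_i v_i (x) h_i = \sum_i (v_i + a_i v) (x) h_i]. The
    list keeps its length, so an induction on length can use this. *)
Lemma tensor_absorb (V X : lmodType k) (s : seq (V * X)) (v : V) (h : X) :
  span (map snd s) h ->
  exists2 s' : seq (V * X), size s' = size s &
    forall (Y : lmodType k) (g : V -> X -> Y), bilinear_map g ->
      \sum_(p <- s') g p.1 p.2 = g v h + \sum_(p <- s) g p.1 p.2.
Proof.
elim: s h => [|[v0 h0] s IHs] h /=.
  move=> ->; exists [::] => // Y g [g1 _].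
  by rewrite !big_nil addr0 (linear_map0 (g1 v)).
move=> [a [y [-> /IHs[s' ss' gs']]]].
exists ((v0 + a *: v, h0) :: s'); first by rewrite /= ss'.
move=> Y g bg; rewrite !big_cons (gs' _ _ bg) /=.
case: bg => g1 g2; rewrite (linear_mapD (g2 h0)) (linear_mapZ (g2 h0)) g1.
by rewrite !addrA; congr (_ + _); rewrite [RHS]addrC addrA.
Qed.

Lemma bilinear_form_map (V X : lmodType k) (f : V -> X -> k) :
  bilinear_form f -> bilinear_map (f : V -> X -> k^o).
Proof. by case. Qed.

(* Induction on [s]: either the first right factor is a combination of the
   others, and is absorbed in them, or a functional isolates it. *)
Lemma tensor0_of_slices (V X : lmodType k) (s : seq (V * X)) :
  (forall L : X -> k, scalar L -> \sum_(p <- s) L p.2 *: p.1 = 0) ->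
  teq2 s [::].
Proof.
have [n] := ubnP (size s); elim: n s => // n IHn [|[v h] s] //= sn sl f bf.
have slice_bilinear (L : X -> k) : scalar L ->
    bilinear_map (fun (u : V) (x : X) => L x *: u).
  move=> lL; split=> [u a x y|x a u w]; first by rewrite lL scalerDl scalerA.
  by rewrite scalerDr !scalerA mulrC.
have [sph|nsph] := pselect (span (map snd s) h).
  have [s' ss' gs'] := tensor_absorb v sph.
  rewrite big_cons /= -(gs' _ _ (bilinear_form_map bf)).
  apply: (IHn s' _ _ f bf); first by rewrite ss'.
  move=> L lL; rewrite (gs' _ _ (slice_bilinear L lL)).
  by have := sl L lL; rewrite big_cons.
have [L [lL L0 Lh]] := separating_functional (span_subspace _) nsph.
have := sl L lL; rewrite big_cons /= Lh scale1r big_seq big1 => [|p ps]; last first.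
  by rewrite L0 ?scale0r //; apply/mem_span/map_f.
rewrite addr0 => v0; rewrite big_cons /= v0.
rewrite (linear_map0 ((bilinear_form_map bf).2 h)) add0r.
apply: (IHn s sn _ f bf) => M lM; have := sl M lM.
by rewrite big_cons /= v0 scaler0 add0r.
Qed.

End LinearAlgebra.

(** * Complete reducibility and integrals *)

Section CompleteReducibility.
Variables (k : fieldType) (V : lmodType k) (A : Type) (act : A -> V -> V).
Hypothesis act_lin : forall a, linear (act a).

Definition stable (W : V -> Prop) : Prop :=
  subspace W /\ forall a w, W w -> W (act a w).

Definition simple_stable (W : V -> Prop) : Prop :=
  stable W /\ (exists w, W w /\ w <> 0) /\
  (forall U, stable U -> (forall u, U u -> W u) ->
     (forall u, U u -> u = 0) \/ (forall w, W w -> U w)).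

Definition complementary (U C : V -> Prop) : Prop :=
  (forall x, U x -> C x -> x = 0) /\
  (forall x, exists u c, [/\ U u, C c & x = u + c]).

Lemma stable0 : stable (fun x => x = 0).
Proof.
split; first by split=> // a x y -> ->; rewrite scaler0 addr0.
by move=> a w ->; rewrite (linear_map0 (act_lin a)).
Qed.

Lemma stableI U W : stable U -> stable W -> stable (fun x => U x /\ W x).
Proof.
move=> [sU aU] [sW aW]; split; last by move=> a w [Uw Ww]; auto.
split; first by split; [apply: sU.1|apply: sW.1].
by move=> a x y [Ux Wx] [Uy Wy]; split; [apply: sU.2|apply: sW.2].
Qed.

Lemma stableD U W : stable U -> stable W ->
  stable (fun x => exists u w, [/\ U u, W w & x = u + w]).
Proof.
move=> [sU aU] [sW aW]; split; last first.
  move=> a _ [u [w [Uu Ww ->]]]; exists (act a u), (act a w).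
  by rewrite (linear_mapD (act_lin a)); split; auto.
split; first by exists 0, 0; rewrite addr0; split; [apply: sU.1|apply: sW.1|].
move=> a _ _ [u [w [Uu Ww ->]]] [u' [w' [Uu' Ww' ->]]].
exists (a *: u + u'), (a *: w + w'); rewrite scalerDr addrACA.
by split; [apply: sU.2|apply: sW.2|].
Qed.

Lemma stable_chain (F : set (V -> Prop)) :
  (forall X, F X -> stable X) -> total_on F subset -> (exists X, F X) ->
  stable (fun x => exists2 X, F X & X x).
Proof.
move=> FP Ftot [X0 FX0]; split; last first.
  by move=> a w [X FX Xw]; exists X => //; apply: (FP X FX).2.
split; first by exists X0 => //; apply: (FP X0 FX0).1.1.
move=> a x y [X FX Xx] [Y FY Yy].
case: (Ftot X Y FX FY) => XY.
  by exists Y => //; apply: (FP Y FY).1.2 => //; apply: XY.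
by exists X => //; apply: (FP X FX).1.2 => //; apply: XY.
Qed.

Hypothesis has_complement :
  forall U, stable U -> exists2 C, stable C & complementary U C.

Lemma exists_simple_stable (M : V -> Prop) :
  stable M -> (exists x, M x /\ x <> 0) ->
  exists2 W, simple_stable W & forall x, W x -> M x.
Proof.
move=> stM [v [Mv v0]].
(* [N] will be maximal among the stable subspaces of [M] that avoid [v]; its complement inside [M]
   is the simple subspace sought. *)
pose P (N : set V) := [/\ stable N, forall x, N x -> M x & ~ N v].
have [||N [_ [stN NM Nv] maxN]] := @zorn_above V P (fun x => x = 0).
- split=> //; first exact: stable0.
  by move=> _ ->; apply: stM.1.1.
- move=> F FP Ftot [X0 FX0]; split.
  + by apply: stable_chain => //; [move=> X /FP[]|exists X0].
  + by move=> x [X /FP[_ XM _]] /XM.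
  + by case=> X /FP[_ _ Xv] /Xv.
have [C0 stC0 [NC0 decN]] := has_complement stN.
pose C x := C0 x /\ M x.
have stC : stable C by apply: stableI.
exists C; last by move=> x [].
(* A proper nonzero [B <= C] with complement [B'] in [C] would give
   [v \in (N + B) :&: (N + B') = N]. *)
have v_in B : stable B -> (forall x, B x -> C x) -> (exists b, B b /\ b <> 0) ->
    exists n b, [/\ N n, B b & v = n + b].
  move=> stB BC [b [Bb b0]]; apply: contrapT => nv.
  apply: b0; apply: NC0; last by apply: (BC _ Bb).1.
  apply: (maxN (fun x => exists n b, [/\ N n, B b & x = n + b])).
  - by move=> x Nx; exists x, 0; rewrite addr0; split=> //; apply: stB.1.1.
  - split=> //; first exact: stableD.
    move=> _ [n [b' [Nn Bb' ->]]].
    by apply: (subspaceD stM.1); [apply: NM|apply: (BC _ Bb').2].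
  - by exists 0, b; rewrite add0r; split=> //; apply: stN.1.1.
split=> //; split.
  have [n [c [Nn Cc vE]]] := decN v.
  exists c; split; first split=> //.
    have -> : c = v - n by rewrite vE addrC addKr.
    by apply: (subspaceB stM.1) => //; apply: NM.
  by move=> c0; apply: Nv; rewrite vE c0 addr0.
move=> B stB BC; apply: contrapT => /not_orP[Bn0 CB].
have [B0 stB0 [BB0 decB]] := has_complement stB.
have Bn : exists b, B b /\ b <> 0.
  apply: contrapT => nb; apply: Bn0 => u Bu; apply: contrapT => u0.
  by apply: nb; exists u.
have B'n : exists b, (B0 b /\ C b) /\ b <> 0.
  apply: contrapT => nb; apply: CB => c Cc.
  have [b [b' [Bb Bb' cE]]] := decB c.
  have b'E : b' = c - b by rewrite cE addrC addKr.
  have b'0 : b' = 0.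
    apply: contrapT => b'0; apply: nb; exists b'; do 2!split=> //.
    by rewrite b'E; apply: (subspaceB stC.1) => //; apply: BC.
  by rewrite cE b'0 addr0.
have [n [b [Nn Bb vE]]] := v_in B stB BC Bn.
have [|n' [b' [Nn' [Bb' Cb'] vE']]] :=
  v_in (fun x => B0 x /\ C x) (stableI stB0 stC) _ B'n; first by move=> x [].
have nn' : n - n' = b' - b.
  by apply/eqP; rewrite subr_eq addrAC -subr_eq opprK -vE addrC -vE'.
have bb' : b' = b.
  apply/eqP; rewrite -subr_eq0; apply/eqP; apply: NC0.
    by rewrite -nn'; apply: (subspaceB stN.1).
  by apply: (subspaceB stC0.1); [apply: Cb'.1|apply: (BC _ Bb).1].
by apply: Nv; rewrite vE (BB0 b) ?addr0 // -bb'.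
Qed.

Inductive in_sum (F : (V -> Prop) -> Prop) : V -> Prop :=
| in_sum0 : in_sum F 0
| in_sum_add W w v : F W -> W w -> in_sum F v -> in_sum F (w + v).

Definition others (F : (V -> Prop) -> Prop) (W : V -> Prop) (W' : V -> Prop) :=
  F W' /\ W' <> W.

Definition independent (F : (V -> Prop) -> Prop) : Prop :=
  forall W w, F W -> W w -> in_sum (others F W) w -> w = 0.

Lemma in_sum_mono (F G : (V -> Prop) -> Prop) x :
  (forall W, F W -> G W) -> in_sum F x -> in_sum G x.
Proof.
move=> FG; elim=> [|W w v FW Ww _ IHv]; first exact: in_sum0.
exact: in_sum_add (FG _ FW) Ww IHv.
Qed.

Lemma in_sumD (F : (V -> Prop) -> Prop) x y :
  in_sum F x -> in_sum F y -> in_sum F (x + y).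
Proof.
move=> Fx Fy; elim: Fx => [|W w v FW Ww _ IHv]; first by rewrite add0r.
by rewrite -addrA; exact: in_sum_add FW Ww IHv.
Qed.

Lemma in_sum1 (F : (V -> Prop) -> Prop) W w : F W -> W w -> in_sum F w.
Proof. by move=> FW Ww; rewrite -[w]addr0; apply: in_sum_add FW Ww (in_sum0 _). Qed.

Lemma in_sum_stable (F : (V -> Prop) -> Prop) :
  (forall W, F W -> stable W) -> stable (in_sum F).
Proof.
move=> FS; split.
  split; first exact: in_sum0.
  move=> a x y Fx Fy; apply: in_sumD Fy.
  elim: Fx => [|W w v FW Ww _ IHv]; first by rewrite scaler0; exact: in_sum0.
  rewrite scalerDr; apply: (in_sum_add FW _ IHv).
  exact: (subspaceZ (FS W FW).1).
move=> a x; elim=> [|W w v FW Ww _ IHv].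
  by rewrite (linear_map0 (act_lin a)); exact: in_sum0.
rewrite (linear_mapD (act_lin a)); apply: (in_sum_add FW _ IHv).
exact: (FS W FW).2.
Qed.

(** Indices must be distinct, so a vector from a member that already occurs is merged with the
    vector of that member. *)
Lemma in_sum_injective_repr (F : (V -> Prop) -> Prop) x :
  (forall W, F W -> stable W) -> in_sum F x ->
  exists (n : nat) (idx : 'I_n -> {W | F W}) (ws : 'I_n -> V),
    injective idx /\ (forall j, sval (idx j) (ws j)) /\ x = \sum_j ws j.
Proof.
move=> FS; elim=> [|W w v FW Ww _ [n [idx [ws [inj_idx [wsP ->]]]]]].
  have no (T : Type) : 'I_0 -> T by case.
  exists 0, (no _), (no _); split; first by case.
  by split; [case|rewrite big_ord0].
pose sW : {W | F W} := exist _ W FW.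
have [[j idxj]|nidx] := pselect (exists j, idx j = sW).
  exists n, idx, (fun i => if i == j then w + ws i else ws i); split=> //; split.
    move=> i; case: eqP => [->|_] //; rewrite idxj /=.
    apply: (subspaceD (FS _ FW).1) => //.
    by have := wsP j; rewrite idxj.
  rewrite (bigD1 j) //= [RHS](bigD1 j) //= eqxx addrA; congr (_ + _).
  by apply: eq_bigr => i /negPf ->.
exists n.+1, (fun i => oapp idx sW (unlift ord0 i)),
  (fun i => oapp ws w (unlift ord0 i)); split; last split.
- move=> i i'; case: unliftP => [j ->|->]; case: unliftP => [j' ->|->] //= e.
  + by rewrite (inj_idx _ _ e).
  + by case: nidx; exists j.
  + by case: nidx; exists j'.
- by move=> i; case: unliftP => [j _|_] /=.
- rewrite big_ord_recl unlift_none /=; congr (_ + _).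
  by apply: eq_bigr => j _; rewrite liftK.
Qed.

Lemma independent_sum0 (F : (V -> Prop) -> Prop) (n : nat)
    (idx : 'I_n -> {W | F W}) (ws : 'I_n -> V) :
  (forall W, F W -> stable W) -> independent F -> injective idx ->
  (forall j, sval (idx j) (ws j)) -> \sum_j ws j = 0 -> forall j, ws j = 0.
Proof.
move=> FS indF inj_idx wsP ws0 j.
have sO : subspace (in_sum (others F (sval (idx j)))).
  by apply: (in_sum_stable _).1 => W [FW _]; apply: FS.
apply: (indF _ _ (svalP (idx j)) (wsP j)).
move: ws0; rewrite (bigD1 j) //= => /eqP; rewrite addr_eq0 => /eqP ->.
rewrite -scaleN1r; apply: (subspaceZ sO).
apply: (big_ind _ (in_sum0 _)) => [|i ij]; first exact: in_sumD.
apply: in_sum1 (wsP i); split; first exact: svalP.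
move=> e; move/negP: ij; apply; apply/eqP/inj_idx.
move: e; case: (idx i) (idx j) => [W1 FW1] [W2 FW2] /= e; exact: eq_exist.
Qed.

Theorem semisimple_of_complements :
  exists (J : Type) (W : J -> V -> Prop),
    (forall i, simple_stable (W i)) /\
    (forall v : V, exists (n : nat) (idx : 'I_n -> J) (ws : 'I_n -> V),
        injective idx /\ (forall j, W (idx j) (ws j)) /\ v = \sum_j ws j) /\
    (forall (n : nat) (idx : 'I_n -> J) (ws : 'I_n -> V),
        injective idx -> (forall j, W (idx j) (ws j)) -> \sum_j ws j = 0 ->
        forall j, ws j = 0).
Proof.
pose P (F : set (V -> Prop)) :=
  (forall W, F W -> simple_stable W) /\ independent F.
have [||F [_ [Fsimple indF] maxF]] := @zorn_above (V -> Prop) P (fun=> False).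
- by split=> // W w [].
- move=> Fs FP Ftot [X0 FX0]; split; first by move=> W [X /FP[XS _]] /XS.
  move=> W w [X FX XW] Ww w_in.
  (* A dependency involves finitely many members, hence lives in a single family [Y] of the
     chain. *)
  have [Y FY [YW w_inY]] : exists2 Y, Fs Y & Y W /\ in_sum (others Y W) w.
    move: w_in; move: {Ww} w => w.
    elim=> [|W' w' v [[Y' FY' Y'W'] W'W] W'w' _ [Y FY [YW IHv]]].
      by exists X => //; split=> //; exact: in_sum0.
    case: (Ftot _ _ FY FY') => YY'; [exists Y' => //|exists Y => //]; split=> //.
    - exact: YY'.
    - apply: (in_sum_add (W := W')) => //.
      by apply: in_sum_mono IHv => W1 [YW1 W1W]; split=> //; apply: YY'.
    - by apply: (in_sum_add (W := W')) => //; split=> //; apply: YY'.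
  by have [_ indY] := FP _ FY; apply: indY YW Ww w_inY.
have FS W : F W -> stable W by move/Fsimple => [].
have [C stC [FC decF]] := has_complement (in_sum_stable FS).
(* A nonzero complement contains a simple [S]. Adding [S] to [F] keeps the family independent, so by
   maximality [S] is in [F], hence inside the sum that the complement meets trivially. *)
have C0 x : C x -> x = 0.
  move=> Cx; apply: contrapT => x0.
  have [|S simS SC] := @exists_simple_stable C stC; first by exists x.
  have [stS [[s [Ss s0]] _]] := simS.
  apply: s0; apply: (FC _); last exact: SC.
  suff FS' : F S by exact: in_sum1 FS' Ss.
  apply: (maxF (fun W => F W \/ W = S)); [by move=> W; left| |by right].
  split; first by move=> W [/Fsimple//|->].
  have split_sum G y : (forall W, G W -> F W \/ W = S) -> in_sum G y ->
      exists s' r, [/\ S s', in_sum (fun W => G W /\ F W) r & y = s' + r].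
    move=> GF; elim=> [|W w v GW Ww _ [s' [r [Ss' r_in ->]]]].
      exists 0, 0; rewrite addr0; split=> //; first exact: stS.1.1.
      exact: in_sum0.
    have [FW|WS] := GF _ GW.
      exists s', (w + r); rewrite addrCA; split=> //.
      by apply: (in_sum_add (W := W)).
    exists (w + s'), r; rewrite addrA; split=> //.
    by apply: (subspaceD stS.1) => //; rewrite -WS.
  move=> W w [FW|->] Ww w_in.
    have [s' [r [Ss' r_in wE]]] := split_sum _ _ (fun W' => @proj1 _ _) w_in.
    have s'E : s' = w - r by rewrite wE addrK.
    have s'0 : s' = 0.
      apply: (FC _); last exact: SC.
      rewrite s'E; apply: (subspaceB (in_sum_stable FS).1).
        exact: in_sum1 FW Ww.
      by apply: in_sum_mono r_in => W' [].
    apply: (indF W w FW Ww); rewrite wE s'0 add0r.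
    by apply: in_sum_mono r_in => W' [[_ W'W] FW'].
  apply: (FC _); last exact: SC.
  by apply: in_sum_mono w_in => W' [[//|->]].
exists {W | F W}, (fun W => sval W); split; last split.
- by move=> [W FW] /=; apply: Fsimple.
- move=> v; apply: in_sum_injective_repr => //.
  by have [u [c [Fu /C0 -> ->]]] := decF v; rewrite addr0.
- by move=> n idx ws; apply: independent_sum0.
Qed.

End CompleteReducibility.

(** * Averaging over a normalised integral, as in Maschke's theorem *)

Section CosemisimplicityCriterion.
Variables (k : fieldType) (H : algType k) (D : hopf_data H).
Hypothesis hopfD : is_hopf D.
Local Notation S := (antipode D).

Variable lam : H -> k.
Hypothesis lam_scalar : scalar lam.
Hypothesis lam1 : lam 1 = 1.
(** In Sweedler notation, [h_1 lam(h_2 S(g)) = lam(h S(g_1)) g_2], tested on functionals. This form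
    of invariance is the one that makes an averaged projection commute with the coaction. *)
Hypothesis lam_invariant : forall L : H -> k, scalar L -> forall h g : H,
  \sum_(q <- comul D h) L q.1 * lam (q.2 * S g) =
  \sum_(q <- comul D g) lam (h * S q.1) * L q.2.

Definition convolution (L M : H -> k) (h : H) : k :=
  \sum_(q <- comul D h) L q.1 * M q.2.

Definition shifted_lam (g h : H) : k := lam (h * S g).

Lemma shifted_lam_scalar g : scalar (shifted_lam g).
Proof. by move=> a x y; rewrite /shifted_lam mulrDl -scalerAl lam_scalar. Qed.

Lemma shifted_lam_linear (h : H) a x y :
  shifted_lam (a *: x + y) h = a * shifted_lam x h + shifted_lam y h.
Proof.
by rewrite /shifted_lam (antipode_linear hopfD) mulrDr -scalerAr lam_scalar.
Qed.

Section Comodule.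
Variables (V : lmodType k) (rho : V -> seq (V * H)).
Hypothesis comodV : is_comodule D rho.

Definition coact_slice (L : H -> k) (v : V) : V :=
  \sum_(p <- rho v) L p.2 *: p.1.

Lemma slice_bilinear (L : H -> k) :
  scalar L -> bilinear_map (fun (u : V) (h : H) => L h *: u).
Proof.
move=> lL; split=> [u a x y|h a u w]; first by rewrite lL scalerDl scalerA.
by rewrite scalerDr !scalerA mulrC.
Qed.

Lemma coact_bilinear_linear (X : lmodType k) (g : V -> H -> X) :
  bilinear_map g -> linear (fun v => \sum_(p <- rho v) g p.1 p.2).
Proof.
move=> bg a x y; rewrite (teq2_bilinear bg (coact_linear comodV a x y)).
rewrite big_cat big_map /= scaler_sumr; congr (_ + _).
by apply: eq_bigr => p _; rewrite (linear_mapZ (bg.2 p.2)).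
Qed.

Lemma coact_slice_linear L : scalar L -> linear (coact_slice L).
Proof. by move/slice_bilinear/coact_bilinear_linear. Qed.

Lemma coact_coassoc_trilinear (X : lmodType k) (g : V -> H -> H -> X) v :
  trilinear_map g ->
  \sum_(p <- rho v) \sum_(q <- rho p.1) g q.1 q.2 p.2 =
  \sum_(p <- rho v) \sum_(q <- comul D p.2) g p.1 q.1 q.2.
Proof.
move=> tg; have := teq3_trilinear tg (coact_coassoc comodV v).
by rewrite !big_allpairs_dep.
Qed.

Lemma coact_slice_comp L M v : scalar L -> scalar M ->
  coact_slice L (coact_slice M v) = coact_slice (convolution L M) v.
Proof.
move=> lL lM; rewrite {2}/coact_slice (linear_map_sum (coact_slice_linear lL)).
transitivity (\sum_(p <- rho v) \sum_(q <- rho p.1) (M p.2 * L q.2) *: q.1).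
  apply: eq_bigr => p _; rewrite (linear_mapZ (coact_slice_linear lL)).
  by rewrite scaler_sumr; apply: eq_bigr => q _; rewrite scalerA.
rewrite (@coact_coassoc_trilinear _ (fun u h h' => (M h' * L h) *: u)).
  apply: eq_bigr => p _; rewrite scaler_suml.
  by apply: eq_bigr => q _; rewrite mulrC.
split=> [h h'|u h'|u h] a x y.
- by rewrite scalerDr !scalerA mulrC.
- by rewrite lL mulrDr scalerDl scalerA mulrCA.
- by rewrite lM mulrDl scalerDl scalerA mulrA.
Qed.

(** A comodule is viewed as a module over the dual of [H]: slices by all functionals detect
    subcomodules, and the results on families of linear operators apply. *)
Definition functional := {L : H -> k | scalar L}.

Definition functional_act (L : functional) : V -> V := coact_slice (sval L).

Lemma functional_act_linear L : linear (functional_act L).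
Proof. exact: coact_slice_linear (svalP L). Qed.

Lemma subcomodule_stable W : subcomodule rho W -> stable functional_act W.
Proof.
move=> [W0 [WD Wrho]]; split=> // L w /Wrho[t [rwt tW]].
rewrite /functional_act /coact_slice.
rewrite (teq2_bilinear (slice_bilinear (svalP L)) rwt).
by apply: subspace_sum_in => // p /tW; apply: subspaceZ.
Qed.

(** Every slice of [rho w] lies in [W], so it is fixed by a projection [p] onto [W]. Hence applying
    [p] to the left factors of [rho w] changes no slice, and so does not change the tensor. *)
Lemma stable_subcomodule W : stable functional_act W -> subcomodule rho W.
Proof.
move=> [sW aW]; case: (sW) => W0 WD; do 2!split=> //.
move=> w Ww; have [p [lp pW pid]] := linear_projection sW.
exists [seq (p q.1, q.2) | q <- rho w]; split=> [f bf|_ /mapP[q _ ->]]; last exact: pW.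
apply/eqP; rewrite -subr_eq0 big_map -sumrB; apply/eqP.
have bf' := bilinear_form_map bf.
transitivity (\sum_(q <- [seq (q.1 - p q.1, q.2) | q <- rho w]) f q.1 q.2).
  by rewrite big_map; apply: eq_bigr => q _; rewrite (linear_mapB (bf'.2 q.2)).
rewrite (tensor0_of_slices _ bf) ?big_nil // => L lL; rewrite big_map /=.
have := pid _ (aW (exist _ L lL) _ Ww).
rewrite /functional_act /coact_slice /= (linear_map_sum lp) => /esym/eqP.
rewrite -subr_eq0 -sumrB => /eqP e; rewrite -[RHS]e; apply: eq_bigr => q _.
by rewrite scalerBr (linear_mapZ lp).
Qed.

Lemma simple_stable_subcomodule W :
  simple_stable functional_act W -> simple_subcomodule rho W.
Proof.
move=> [stW [nzW simW]]; split; first exact: stable_subcomodule.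
by split=> // U /subcomodule_stable; apply: simW.
Qed.

Section Averaging.
Variables (U : V -> Prop) (p : V -> V).
Hypotheses (stU : stable functional_act U) (lin_p : linear p).
Hypotheses (pU : forall x, U (p x)) (pid : forall x, U x -> p x = x).

(** Maschke's average: [v] goes to [p(v_0)_0 lam(p(v_0)_1 S(v_1))]. *)
Definition average (v : V) : V :=
  \sum_(a <- rho v) coact_slice (shifted_lam a.2) (p a.1).

Lemma shifted_slice_linear (u : V) : linear (fun h => coact_slice (shifted_lam h) u).
Proof.
move=> a x y; rewrite /coact_slice scaler_sumr -big_split; apply: eq_bigr => q _.
by rewrite /= shifted_lam_linear scalerDl scalerA.
Qed.

Lemma average_bilinear (f : V -> V) : linear f ->
  bilinear_map (fun u h => coact_slice (shifted_lam h) (f u)).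
Proof.
move=> lf; split=> [u|h a x y]; first exact: shifted_slice_linear.
by rewrite lf (coact_slice_linear (shifted_lam_scalar h)).
Qed.

Lemma average_linear : linear average.
Proof. exact: coact_bilinear_linear (average_bilinear lin_p). Qed.

Lemma average_in v : U (average v).
Proof.
apply: (subspace_sum stU.1) => a.
exact: (stU.2 (exist _ _ (shifted_lam_scalar a.2))).
Qed.

Lemma average_id u : U u -> average u = u.
Proof.
move=> Uu; have [_ [_ /(_ u Uu)[t [rut tU]]]] := stable_subcomodule stU.
(* The left factors of [rho u] need not lie in [U], so [p] is removed on the representative [t],
   where they do, before returning to [rho u]. What remains is [u_0 lam(u_1 S(u_2)) = u_0 eps(u_1)
   lam(1) = u]. *)
rewrite /average (teq2_bilinear (average_bilinear lin_p) rut).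
rewrite big_seq (eq_bigr (fun a => coact_slice (shifted_lam a.2) a.1)); last first.
  by move=> a /tU /pid ->.
rewrite -big_seq.
rewrite -(teq2_bilinear (@average_bilinear id _) rut); last by [].
rewrite (@coact_coassoc_trilinear _ (fun u h h' => shifted_lam h' h *: u)).
  rewrite -[RHS](coact_counit comodV); apply: eq_bigr => a _.
  rewrite -scaler_suml; congr (_ *: _).
  rewrite -(linear_map_sum (scalar_linear lam_scalar)) (antipode_right hopfD).
  by rewrite (linear_mapZ (scalar_linear lam_scalar)) lam1; exact: mulr1.
split=> [h h'|w h'|w h] a x y.
- by rewrite scalerDr !scalerA mulrC.
- by rewrite shifted_lam_scalar scalerDl scalerA.
- by rewrite shifted_lam_linear scalerDl scalerA.
Qed.

(** Slicing the average by [L] convolves [L] with [shifted_lam] on the coaction of [p v_0];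
    invariance of [lam] transfers [L] to the coaction of [v]. *)
Lemma average_act L v : functional_act L (average v) = average (functional_act L v).
Proof.
case: L => L lL; rewrite /functional_act /= {1}/average.
rewrite (linear_map_sum (coact_slice_linear lL)).
transitivity (\sum_(a <- rho v) \sum_(q <- comul D a.2)
    L q.2 *: coact_slice (shifted_lam q.1) (p a.1)).
  apply: eq_bigr => a _; rewrite (coact_slice_comp _ lL (shifted_lam_scalar _)).
  rewrite /coact_slice.
  under [RHS]eq_bigr do rewrite scaler_sumr.
  rewrite exchange_big; apply: eq_bigr => b _ /=.
  rewrite /convolution /shifted_lam lam_invariant // scaler_suml.
  by apply: eq_bigr => q _; rewrite scalerA mulrC.
rewrite -(@coact_coassoc_trilinear _
  (fun u h h' => L h' *: coact_slice (shifted_lam h) (p u))).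
  rewrite /coact_slice (linear_map_sum average_linear); apply: eq_bigr => a _.
  by rewrite (linear_mapZ average_linear) -scaler_sumr.
split=> [h h'|u h'|u h] a x y.
- rewrite lin_p (coact_slice_linear (shifted_lam_scalar h)).
  by rewrite scalerDr !scalerA mulrC.
- by rewrite shifted_slice_linear scalerDr !scalerA mulrC.
- by rewrite lL scalerDl scalerA.
Qed.

End Averaging.

Lemma stable_complement U : stable functional_act U ->
  exists2 C, stable functional_act C & complementary U C.
Proof.
move=> stU; have [p [lp pU pid]] := linear_projection stU.1.
have lA := average_linear lp.
exists (fun v => average p v = 0).
  split; first split.
  - exact: linear_map0 lA.
  - by move=> a x y x0 y0; rewrite lA x0 y0 scaler0 addr0.
  move=> L w w0; rewrite -(average_act lp) w0.
  exact: linear_map0 (functional_act_linear L).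
split=> [x Ux|x]; first by rewrite (average_id stU lp pid Ux).
exists (average p x), (x - average p x); split.
- exact: average_in.
- by rewrite (linear_mapB lA) (average_id stU lp pid (average_in stU pU x)) subrr.
- by rewrite addrC subrK.
Qed.

Lemma comodule_semisimple : direct_sum_of_simples rho.
Proof.
have [J [W [simW [genW indW]]]] :=
  semisimple_of_complements functional_act_linear stable_complement.
by exists J, W; split=> // i; apply: simple_stable_subcomodule.
Qed.

End Comodule.

Theorem cosemisimple_of_integral : cosemisimple D.
Proof. by move=> V rho; exact: comodule_semisimple. Qed.

End CosemisimplicityCriterion.

(** * Projections on invariant tensors *)

Section JonesWenzl.
Variables (k : fieldType) (M : lmodType k).
Hypothesis char0 : [pchar k] =i pred0.
Variables cap cup : nat -> M -> M.
Hypothesis cap_lin : forall i, linear (cap i).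
Hypothesis cup_lin : forall i, linear (cup i).
Hypothesis cap_cup : forall i x, cap i (cup i x) = 2%:R *: x.
Hypothesis cap_cupS : forall i x, cap i (cup i.+1 x) = x.
Hypothesis capS_cup : forall i x, cap i.+1 (cup i x) = x.
Hypothesis cap_cup_far : forall i j x, (i <= j)%N ->
  cap i (cup j.+2 x) = cup j (cap i x).
Hypothesis cap_far_cup : forall i j x, (j <= i)%N ->
  cap i.+2 (cup j x) = cup j (cap i x).
Hypothesis cup_cup_far : forall i j x, (i <= j)%N ->
  cup j.+2 (cup i x) = cup i (cup j x).
Hypothesis cap_cap_far : forall i j x, (i <= j)%N ->
  cap i (cap j.+2 x) = cap j (cap i x).

Let natk_neq0 n : n.+1%:R != 0 :> k.
Proof. by have /pcharf0P -> := char0. Qed.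

Definition tl i x := cup i (cap i x).

Lemma tl_lin i : linear (tl i).
Proof. by move=> a x y; rewrite /tl cap_lin cup_lin. Qed.

Lemma tl_tl i x : tl i (tl i x) = 2%:R *: tl i x.
Proof. by rewrite /tl cap_cup (linear_mapZ (cup_lin i)). Qed.

Lemma tl_tlS_tl i x : tl i.+1 (tl i (tl i.+1 x)) = tl i.+1 x.
Proof. by rewrite /tl capS_cup cap_cupS. Qed.

Lemma tl_comm i j x : (i <= j)%N -> tl j.+2 (tl i x) = tl i (tl j.+2 x).
Proof.
by move=> ij; rewrite /tl cap_far_cup // cup_cup_far // cap_cup_far // cap_cap_far.
Qed.

(* For loop value [2] the quantum integers are the integers, so the Jones-Wenzl
   recursion has the coefficients [r.+1 / r.+2]. *)
Definition jw_coef (r : nat) : k := r.+1%:R / r.+2%:R.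

(** [jw r] is the idempotent on [r.+1] strands, which [tl j] annihilates for [j < r]. *)
Fixpoint jw (r : nat) (x : M) : M :=
  if r is s.+1 then jw s x - jw_coef s *: jw s (tl s (jw s x)) else x.

Lemma jw_lin r : linear (jw r).
Proof.
elim: r => //= r IHr a x y; rewrite !(IHr, tl_lin) scalerBr scalerDr !scalerA.
by rewrite opprD addrACA mulrC.
Qed.

Lemma jw_0 r : jw r 0 = 0. Proof. exact: linear_map0 (jw_lin r). Qed.
Lemma tl_0 i : tl i 0 = 0. Proof. exact: linear_map0 (tl_lin i). Qed.

Lemma jw_comm r j x : (r < j)%N -> tl j (jw r x) = jw r (tl j x).
Proof.
elim: r x => //= r IHr x rj; have lt_rj := ltnW rj.
rewrite (linear_mapB (tl_lin j)) (linear_mapZ (tl_lin j)) !(IHr _ lt_rj).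
congr (_ - _ *: jw r _); rewrite -(IHr _ lt_rj).
by case: j rj {IHr lt_rj} => [|[|j]] // rj; apply: tl_comm.
Qed.

Section Absorption.
Variable r : nat.
Hypothesis tl_jw0 : forall j x, (j < r)%N -> tl j (jw r x) = 0.
Hypothesis jw_tl0 : forall j x, (j < r)%N -> jw r (tl j x) = 0.

Lemma jw_absorbl t x : (t <= r)%N -> jw t (jw r x) = jw r x.
Proof.
elim: t => //= t IHt tr.
by rewrite (IHt (ltnW tr)) tl_jw0 // jw_0 scaler0 subr0.
Qed.

Lemma jw_absorbr t x : (t <= r)%N -> jw r (jw t x) = jw r x.
Proof.
elim: t x => //= t IHt x tr; rewrite (linear_mapB (jw_lin r)).
rewrite (linear_mapZ (jw_lin r)) !IHt; try exact: ltnW.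
by rewrite jw_tl0 // scaler0 subr0.
Qed.

End Absorption.

Lemma jw_coef_neq0 r : jw_coef r != 0.
Proof. by rewrite mulf_neq0 ?invr_eq0 ?natk_neq0. Qed.

Lemma jw_coefS r : 2%:R - jw_coef r = (jw_coef r.+1)^-1.
Proof.
rewrite /jw_coef invf_div; apply: (mulIf (natk_neq0 r.+1)).
rewrite mulrBl !mulfVK ?natk_neq0 // -natrM -natrB; last first.
  exact: leq_trans (leqnSn _) (leq_pmull _ _).
by congr (_%:R); rewrite mul2n -addnn -addSnnS addnK.
Qed.

(** The three claims feed each other. The partial trace settles the top index in both vanishing
    claims; vanishing makes [jw r] idempotent, which gives the next partial trace with factor
    [2 - jw_coef r = (jw_coef r.+1)^-1]. At [r = 0] the truncated [r.-1] is correct because [jw 0]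
    is the identity. *)
Lemma jw_annihilates r :
  [/\ forall j x, (j < r)%N -> tl j (jw r x) = 0,
      forall j x, (j < r)%N -> jw r (tl j x) = 0 &
      forall x, tl r (jw r (tl r x)) = (jw_coef r)^-1 *: jw r.-1 (tl r x)].
Proof.
elim: r => [|r [tl_jw0 jw_tl0 partial_trace]].
  by split=> //= x; rewrite tl_tl /jw_coef invf_div divr1.
have cK z : jw_coef r *: ((jw_coef r)^-1 *: z) = z.
  by rewrite scalerA divff ?jw_coef_neq0 // scale1r.
split=> [j x|j x|x].
- rewrite ltnS leq_eqVlt /= (linear_mapB (tl_lin j)) (linear_mapZ (tl_lin j)).
  case/predU1P=> [->|jr]; last by rewrite !tl_jw0 // scaler0 subr0.
  rewrite partial_trace cK; case: r tl_jw0 {jw_tl0 partial_trace cK} => [|r] tl_jw0.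
    by rewrite subrr.
  by rewrite -jw_comm // (jw_absorbl tl_jw0) // subrr.
- rewrite ltnS leq_eqVlt /=.
  case/predU1P=> [->|jr]; last by rewrite jw_tl0 // tl_0 jw_0 scaler0 subr0.
  rewrite partial_trace (linear_mapZ (jw_lin r)) cK (jw_absorbr jw_tl0) ?leq_pred //.
  by rewrite subrr.
- rewrite /= (linear_mapB (tl_lin _)) (linear_mapZ (tl_lin _)).
  rewrite !(jw_comm _ (ltnSn r)) -(jw_comm x (ltnSn r)) tl_tl tl_tlS_tl.
  rewrite (jw_comm x (ltnSn r)) (jw_absorbl tl_jw0) //.
  by rewrite (linear_mapZ (jw_lin r)) -scalerBl jw_coefS.
Qed.

Lemma cap_jw r j x : (j < r)%N -> cap j (jw r x) = 0.
Proof.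
have [tl_jw0 _ _] := jw_annihilates r => jr.
have := congr1 (cap j) (tl_jw0 j x jr); rewrite /tl cap_cup.
rewrite (linear_map0 (cap_lin j)) => /eqP.
by rewrite scaler_eq0 (negPf (natk_neq0 1)) => /eqP.
Qed.

Lemma jw_cup r j x : (j < r)%N -> jw r (cup j x) = 0.
Proof.
have [_ jw_tl0 _] := jw_annihilates r => jr.
have := jw_tl0 j (cup j x) jr; rewrite /tl cap_cup.
rewrite (linear_mapZ (cup_lin j)) (linear_mapZ (jw_lin r)) => /eqP.
by rewrite scaler_eq0 (negPf (natk_neq0 1)) => /eqP.
Qed.

Lemma jw_resolution r x :
  \sum_(t < r) jw_coef t *: jw t (tl t (jw t x)) = x - jw r x.
Proof.
elim: r => [|r IHr]; first by rewrite big_ord0 /= subrr.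
by rewrite big_ord_recr /= IHr opprB addrAC addrA.
Qed.

(* Obtained from [1 - jw n.+1 = \sum_t c_t *: jw t \o cup t \o cap t \o jw t]
   by inserting the projection on [n] strands in the middle of each term. *)
Fixpoint inv_proj (n : nat) (x : M) : M :=
  match n with
  | 0 => x
  | 1 => 0
  | n'.+2 => \sum_(t < n'.+1)
      jw_coef t *: jw t (cup t (inv_proj n' (cap t (jw t x))))
  end.

Lemma nat_ind2 (P : nat -> Prop) :
  P 0 -> P 1 -> (forall n, P n -> P n.+2) -> forall n, P n.
Proof.
move=> P0 P1 PSS n; suff: P n /\ P n.+1 by case.
by elim: n => [|n [Pn PSn]]; split=> //; apply: PSS.
Qed.

Lemma inv_proj_lin n : linear (inv_proj n).
Proof.
elim/nat_ind2: n => [//|a x y /=|n IHn a x y /=].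
  by rewrite scaler0 addr0.
rewrite scaler_sumr -big_split; apply: eq_bigr => t _ /=.
rewrite jw_lin cap_lin IHn cup_lin jw_lin scalerDr !scalerA.
by rewrite mulrC.
Qed.

Section Commutation.
Variable n : nat.
Local Notation inv := (inv_proj n).
Hypothesis inv_comm : forall i j x, (i <= n)%N -> (j <= n)%N ->
  cap i (cup j (inv x)) = inv (cap i (cup j x)).

(** Unfolding [jw t] leaves alternating caps and cups, and the projection passes through each pair.
    The pairs [(t, j)] and [(i, t)] that arise require generality in [i] and [j]. *)
Lemma inv_cap_jw_cup t i j x : (i <= n)%N -> (j <= n)%N -> (t <= n.+1)%N ->
  cap i (jw t (cup j (inv x))) = inv (cap i (jw t (cup j x))).
Proof.
move=> + + tn; elim: t tn i j x => [|t IHt] /= tn i j x le_in le_jn.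
  exact: inv_comm.
have le_tn := ltnW tn.
rewrite (linear_mapB (cap_lin i)) (linear_mapZ (cap_lin i)) /tl !IHt //.
rewrite (linear_mapB (cap_lin i)) (linear_mapZ (cap_lin i)).
by rewrite (linear_mapB (inv_proj_lin n)) (linear_mapZ (inv_proj_lin n)).
Qed.

(** Pulling the inner projection out of every term leaves the sum of [jw_resolution], equal to
    [x - jw n.+1 x]; the idempotent then dies against [cap i] or [cup i]. *)
Lemma inv_proj_comm_step i : (i <= n)%N ->
  (forall x, cap i (inv_proj n.+2 x) = inv (cap i x)) /\
  (forall x, inv_proj n.+2 (cup i x) = cup i (inv x)).
Proof.
move=> le_in; split=> x.
  rewrite /= (linear_map_sum (cap_lin i)).
  under eq_bigr => t _.
    rewrite (linear_mapZ (cap_lin i)) inv_cap_jw_cup //; [|exact: ltnSE|exact: ltnW].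
    rewrite -(linear_mapZ (inv_proj_lin n)) -(linear_mapZ (cap_lin i)).
    over.
  rewrite -(linear_map_sum (inv_proj_lin n)) -(linear_map_sum (cap_lin i)).
  by rewrite jw_resolution (linear_mapB (cap_lin i)) cap_jw // subr0.
rewrite /=; under eq_bigr => t _.
  rewrite -inv_cap_jw_cup //; [|exact: ltnSE|exact: ltnW].
  over.
by rewrite jw_resolution jw_cup // subr0.
Qed.

End Commutation.

Lemma inv_cap_cup_near n i j x : (i <= j.+1)%N -> (j <= i.+1)%N ->
  cap i (cup j (inv_proj n x)) = inv_proj n (cap i (cup j x)).
Proof.
rewrite leq_eqVlt => /predU1P[->|]; first by rewrite !capS_cup.
rewrite ltnS => ij; rewrite leq_eqVlt => /predU1P[->|]; first by rewrite !cap_cupS.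
rewrite ltnS => ji; have -> : i = j by apply/eqP; rewrite eqn_leq ij.
by rewrite !cap_cup (linear_mapZ (inv_proj_lin n)).
Qed.

(** For neighbouring indices [cap i] after [cup j] is a scalar. For distant ones the two slide past
    each other, and the projections on [n] and [n.+2] strands are exchanged by the previous step of
    the induction, once by a cap and once by a cup. *)
Lemma inv_cap_cup n i j x : (i <= n)%N -> (j <= n)%N ->
  cap i (cup j (inv_proj n x)) = inv_proj n (cap i (cup j x)).
Proof.
elim/nat_ind2: n i j x => [||n IHn] i j x le_in le_jn.
- by apply: inv_cap_cup_near; [exact: leq_trans le_in _|exact: leq_trans le_jn _].
- by apply: inv_cap_cup_near; [exact: leq_trans le_in _|exact: leq_trans le_jn _].
have comm_n := inv_proj_comm_step IHn.
have [far|near] := leqP i.+2 j.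
  case: j far le_jn => [|[|j]] // ij jn.
  rewrite !cap_cup_far // (comm_n i (leq_trans ij jn)).1.
  by rewrite (comm_n j jn).2.
have [far|near'] := leqP j.+2 i; last exact: inv_cap_cup_near.
case: i far le_in {near} => [|[|i]] // ji le_in.
by rewrite !cap_far_cup // (comm_n i le_in).1 (comm_n j (leq_trans ji le_in)).2.
Qed.

Lemma cap_inv_proj n i x : (i <= n)%N ->
  cap i (inv_proj n.+2 x) = inv_proj n (cap i x).
Proof.
by move=> le_in; have [-> _] := inv_proj_comm_step (@inv_cap_cup n) le_in.
Qed.

Lemma inv_proj_cup n i x : (i <= n)%N ->
  inv_proj n.+2 (cup i x) = cup i (inv_proj n x).
Proof.
by move=> le_in; have [_ ->] := inv_proj_comm_step (@inv_cap_cup n) le_in.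
Qed.

(** [U n] will be the [n]-th tensor power of the matrix [x] with a functional applied to its
    entries; the conclusion says that [inv_proj n] has invariant values. [U] slides through [jw t]
    and [cup t] down to the projection on two strands fewer. *)
Lemma intertwiner_inv_proj (U : nat -> M -> M) (a : k) :
  (forall n, linear (U n)) -> (forall x, U 0 x = a *: x) ->
  (forall n i x, (i <= n)%N -> U n.+2 (cup i x) = cup i (U n x)) ->
  (forall n i x, (i <= n)%N -> cap i (U n.+2 x) = U n (cap i x)) ->
  forall n x, U n (inv_proj n x) = a *: inv_proj n x.
Proof.
move=> U_lin U0 U_cup cap_U.
have U_jw n t x : (t <= n.+1)%N -> U n.+2 (jw t x) = jw t (U n.+2 x).
  elim: t x => //= t IHt x tn; have le_tn := ltnW tn.
  rewrite (linear_mapB (U_lin _)) (linear_mapZ (U_lin _)) !IHt //.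
  by rewrite /tl U_cup // -cap_U // IHt.
elim/nat_ind2 => [|x|n IHn x] //=; first by rewrite (linear_map0 (U_lin 1)) scaler0.
rewrite (linear_map_sum (U_lin _)) scaler_sumr; apply: eq_bigr => t _.
have le_tn : (t <= n)%N by rewrite -ltnS.
rewrite (linear_mapZ (U_lin _)) U_jw ?leqW // U_cup // IHn.
by rewrite (linear_mapZ (cup_lin _)) (linear_mapZ (jw_lin _)) !scalerA mulrC.
Qed.

End JonesWenzl.

(** * Concrete caps and cups on tensors, and the Haar functional on words *)

Section Streams.
Variable I : Type.

Definition scons (a : I) (w : nat -> I) (n : nat) : I :=
  if n is m.+1 then w m else a.

Definition stail (w : nat -> I) (n : nat) : I := w n.+1.

Lemma scons_stail w : scons (w 0) (stail w) = w.
Proof. by apply: funext => -[]. Qed.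

End Streams.

Section Haar.
Variables (k : fieldType) (I : finType) (s : I -> I) (c : I -> k).
Hypothesis char0 : [pchar k] =i pred0.
Hypothesis sK : involutive s.
Hypothesis c_neq0 : forall a, c a != 0.
Hypothesis loop2 : \sum_a c a / c (s a) = 2%:R.

Definition word := seq (I * I).

(* [balanced phi] says that [phi], extended linearly to the free algebra on the
   entries of a matrix [x], vanishes on the ideal of the relations
   [x E x^T = E] and [x^T E^-1 x = E^-1], where [E a (s a) = c a] are the only
   nonzero entries of [E]. *)
Definition balanced (phi : word -> k) : Prop :=
  (forall w1 w2 i j,
     \sum_a c a * phi (w1 ++ (i, a) :: (j, s a) :: w2) =
     (j == s i)%:R * c i * phi (w1 ++ w2)) /\
  (forall w1 w2 i j,
     \sum_a (c (s a))^-1 * phi (w1 ++ (a, i) :: (s a, j) :: w2) =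
     (j == s i)%:R * (c (s i))^-1 * phi (w1 ++ w2)).

(* Tensors on the infinite power of the space with basis [I]: a word in [cap]
   and [cup] acts on finitely many factors, so tensors of all lengths live in
   one space. *)
Definition tensor := (nat -> I) -> k^o.
Implicit Types (f g : tensor) (w : nat -> I) (A B : tensor -> tensor).

Definition shift A : tensor -> tensor :=
  fun f w => A (fun v => f (scons (w 0) v)) (stail w).

Definition cap0 : tensor -> tensor :=
  fun f w => \sum_a (c (s a))^-1 * f (scons a (scons (s a) w)).

Definition cup0 : tensor -> tensor :=
  fun f w => (w 1 == s (w 0))%:R * c (w 0) * f (stail (stail w)).

Definition cap (i : nat) : tensor -> tensor := iter i shift cap0.
Definition cup (i : nat) : tensor -> tensor := iter i shift cup0.

Lemma shift_lin A : linear A -> linear (shift A).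
Proof. by move=> lA a f g; apply: funext => w; rewrite /shift [LHS]/= lA. Qed.

Lemma cap0_lin : linear cap0.
Proof.
move=> a f g; apply: funext => w.
rewrite -[RHS]/(a * cap0 f w + cap0 g w) /cap0 mulr_sumr -big_split /=.
apply: eq_bigr => b _.
by rewrite -[(a *: f + g) _]/(a * f _ + g _) mulrDr [X in X + _]mulrCA.
Qed.

Lemma cup0_lin : linear cup0.
Proof.
move=> a f g; apply: funext => w.
rewrite -[RHS]/(a * cup0 f w + cup0 g w) /cup0.
by rewrite -[(a *: f + g) _]/(a * f _ + g _) mulrDr [X in X + _]mulrCA.
Qed.

Lemma cap_lin i : linear (cap i).
Proof. by elim: i => [|i IHi]; [exact: cap0_lin|exact: shift_lin]. Qed.

Lemma cup_lin i : linear (cup i).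
Proof. by elim: i => [|i IHi]; [exact: cup0_lin|exact: shift_lin]. Qed.

(** Source of the distant commutations: [cup0] concerns only the first two factors, which
    [shift (shift A)] does not touch. For fixed first entries [cup0] is a multiplication by a
    scalar, so linearity of [A] suffices. *)
Lemma linear_cup0_comm A f : linear A ->
  shift (shift A) (cup0 f) = cup0 (A f).
Proof.
move=> lA; apply: funext => w; rewrite /cup0.
pose r := (w 1 == s (w 0))%:R * c (w 0).
exact: (congr1 (fun g : tensor => g (stail (stail w))) (linear_mapZ lA r f)).
Qed.

Lemma linear_cap0_comm A f : linear A ->
  cap0 (shift (shift A) f) = A (cap0 f).
Proof.
move=> lA.
have -> : cap0 f =
    \sum_a (c (s a))^-1 *: ((fun v => f (scons a (scons (s a) v))) : tensor).
  by apply: funext => w; rewrite fct_sumE.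
rewrite (linear_map_sum lA); apply: funext => w; rewrite fct_sumE.
by apply: eq_bigr => a _; rewrite (linear_mapZ lA).
Qed.

Lemma cap_cup i f : cap i (cup i f) = 2%:R *: f.
Proof.
elim: i f => [|i IHi] f; apply: funext => w.
  rewrite /cap /= /cap0 /cup0 /= -[RHS]/(_ * _) -loop2 mulr_suml.
  by apply: eq_bigr => a _; rewrite eqxx mul1r mulrA [_^-1 * _]mulrC.
rewrite -[LHS]/(cap i (cup i (fun v => f (scons (w 0) v))) (stail w)) IHi.
by rewrite -[LHS]/(_ * f (scons _ _)) scons_stail.
Qed.

Lemma cap_cupS i f : cap i (cup i.+1 f) = f.
Proof.
elim: i f => [|i IHi] f; apply: funext => w; last first.
  rewrite -[LHS]/(cap i (cup i.+1 (fun v => f (scons (w 0) v))) (stail w)) IHi.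
  by rewrite scons_stail.
rewrite /cap /= /cap0 /cup /= /shift /cup0 /= (bigD1 (w 0)) //= big1 => [|a].
  rewrite sK eqxx mul1r mulrA mulVf // mul1r addr0.
  by rewrite -[X in f X]/(scons (w 0) (stail w)) scons_stail.
by rewrite sK eq_sym => /negPf ->; rewrite !mul0r mulr0.
Qed.

Lemma capS_cup i f : cap i.+1 (cup i f) = f.
Proof.
elim: i f => [|i IHi] f; apply: funext => w; last first.
  rewrite -[LHS]/(cap i.+1 (cup i (fun v => f (scons (w 0) v))) (stail w)) IHi.
  by rewrite scons_stail.
rewrite /cap /= /shift /cap0 /cup /= /cup0 /= (bigD1 (s (w 0))) //= big1 => [|a].
  rewrite sK eqxx mul1r mulrA mulVf // mul1r addr0.
  by rewrite -[X in f X]/(scons (w 0) (stail w)) scons_stail.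
by move=> /negPf ->; rewrite !mul0r mulr0.
Qed.

Lemma cap_cup_far i j f : (i <= j)%N -> cap i (cup j.+2 f) = cup j (cap i f).
Proof.
elim: i j f => [|i IHi] j f; first by move=> _; exact: (linear_cap0_comm f (cup_lin _)).
case: j => // j ij; apply: funext => w.
exact: (congr1 (fun g : tensor => g (stail w)) (IHi _ (fun v => f (scons (w 0) v)) ij)).
Qed.

Lemma cap_far_cup i j f : (j <= i)%N -> cap i.+2 (cup j f) = cup j (cap i f).
Proof.
elim: j i f => [|j IHj] i f; first by move=> _; exact: (linear_cup0_comm f (cap_lin _)).
case: i => // i ij; apply: funext => w.
exact: (congr1 (fun g : tensor => g (stail w)) (IHj _ (fun v => f (scons (w 0) v)) ij)).
Qed.

Lemma cup_cup_far i j f : (i <= j)%N -> cup j.+2 (cup i f) = cup i (cup j f).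
Proof.
elim: i j f => [|i IHi] j f; first by move=> _; exact: (linear_cup0_comm f (cup_lin _)).
case: j => // j ij; apply: funext => w.
exact: (congr1 (fun g : tensor => g (stail w)) (IHi _ (fun v => f (scons (w 0) v)) ij)).
Qed.

Lemma cap_cap_far i j f : (i <= j)%N -> cap i (cap j.+2 f) = cap j (cap i f).
Proof.
elim: i j f => [|i IHi] j f; first by move=> _; exact: (linear_cap0_comm f (cap_lin _)).
case: j => // j ij; apply: funext => w.
exact: (congr1 (fun g : tensor => g (stail w)) (IHi _ (fun v => f (scons (w 0) v)) ij)).
Qed.

Local Notation proj := (inv_proj cap cup).

Lemma proj_lin n : linear (proj n).
Proof. exact: inv_proj_lin cap_lin cup_lin n. Qed.

Lemma cap_proj n i f : (i <= n)%N -> cap i (proj n.+2 f) = proj n (cap i f).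
Proof.
exact: (cap_inv_proj char0 cap_lin cup_lin cap_cup cap_cupS capS_cup cap_cup_far
          cap_far_cup cup_cup_far cap_cap_far).
Qed.

Lemma proj_cup n i f : (i <= n)%N -> proj n.+2 (cup i f) = cup i (proj n f).
Proof.
exact: (inv_proj_cup char0 cap_lin cup_lin cap_cup cap_cupS capS_cup cap_cup_far
          cap_far_cup cup_cup_far cap_cap_far).
Qed.

Lemma linear_tensor_sum A (J : Type) (r : seq J) (F : J -> tensor) w :
  linear A -> A (fun v => \sum_(j <- r) F j v) w = \sum_(j <- r) A (F j) w.
Proof.
move=> lA; have <- : \sum_(j <- r) F j = (fun v => \sum_(j <- r) F j v) :> tensor.
  by apply: funext => v; rewrite fct_sumE.
by rewrite (linear_map_sum lA) fct_sumE.
Qed.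

Lemma linear_tensorZ A (r : k) f w :
  linear A -> A (fun v => r * f v) w = r * A f w.
Proof. by move=> lA; exact: (congr1 (fun g : tensor => g w) (linear_mapZ lA r f)). Qed.

Fixpoint ind (J : seq I) : tensor := fun w =>
  if J is j :: J' then (w 0 == j)%:R * ind J' (stail w) else 1.

Lemma cup_ind J1 J2 w :
  cup (size J1) (ind (J1 ++ J2)) w = \sum_a c a * ind (J1 ++ a :: s a :: J2) w.
Proof.
elim: J1 w => [|j J1 IHJ] w /=.
  rewrite /cup /= /cup0 (bigD1 (w 0)) //= big1 => [|a].
    by rewrite eqxx mul1r addr0 mulrCA mulrA.
  by rewrite eq_sym => /negPf ->; rewrite mul0r mulr0.
rewrite -[LHS]/(cup (size J1) (fun v => (w 0 == j)%:R * ind (J1 ++ J2) v) (stail w)).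
rewrite (linear_tensorZ _ _ _ (cup_lin _)) IHJ mulr_sumr.
by apply: eq_bigr => a _; rewrite mulrCA.
Qed.

Lemma cap_ind J1 J2 i j w :
  cap (size J1) (ind (J1 ++ i :: j :: J2)) w =
  (j == s i)%:R * (c (s i))^-1 * ind (J1 ++ J2) w.
Proof.
elim: J1 w => [|l J1 IHJ] w /=.
  rewrite /cap /= /cap0 (bigD1 i) //= big1 => [|a /negPf].
    by rewrite eqxx mul1r addr0 mulrA [_^-1 * _]mulrC eq_sym.
  by rewrite /= => ->; rewrite mul0r mulr0.
rewrite -[LHS]/(cap (size J1)
  (fun v => (w 0 == l)%:R * ind (J1 ++ i :: j :: J2) v) (stail w)).
by rewrite (linear_tensorZ _ _ _ (cap_lin _)) IHJ mulrCA.
Qed.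

Variable i0 : I.

Definition ext (K : seq I) : nat -> I := foldr (@scons I) (fun=> i0) K.

Lemma cup_ext K1 K2 i j f :
  cup (size K1) f (ext (K1 ++ i :: j :: K2)) =
  (j == s i)%:R * c i * f (ext (K1 ++ K2)).
Proof. by elim: K1 f => [|l K1 IHK] f //; exact: IHK. Qed.

Lemma cap_ext K1 K2 f :
  cap (size K1) f (ext (K1 ++ K2)) =
  \sum_a (c (s a))^-1 * f (ext (K1 ++ a :: s a :: K2)).
Proof. by elim: K1 f => [|l K1 IHK] f //; exact: IHK. Qed.

(** The integral of [x_(i1 j1) ... x_(in jn)] is the entry, in row [i1 ... in] and column
    [j1 ... jn], of the projection on invariants. *)
Definition haar (z : word) : k :=
  proj (size [seq x.2 | x <- z]) (ind [seq x.2 | x <- z]) (ext [seq x.1 | x <- z]).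

(** Contracting two columns feeds a cup into the projection, and contracting two rows puts a cap
    after it. Both pass through and leave the projection on two strands fewer. *)
Lemma haar_balanced : balanced haar.
Proof.
split=> w1 w2 i j; rewrite /haar !map_cat /=.
  set J1 := map _ w1; set J2 := map _ w2; set K1 := map _ w1; set K2 := map _ w2.
  have sJK : size K1 = size J1 by rewrite !size_map.
  have sJ a : size (J1 ++ a :: s a :: J2) = (size (J1 ++ J2)).+2.
    by rewrite !size_cat /= !addnS.
  under eq_bigr do rewrite !map_cat /= sJ -(linear_tensorZ _ _ _ (proj_lin _)).
  rewrite -(linear_tensor_sum _ _ _ (proj_lin _)).
  under [X in proj _ X]funext do rewrite -cup_ind.
  rewrite proj_cup ?size_cat ?leq_addr //.
  by rewrite -sJK cup_ext.
set J1 := map _ w1; set J2 := map _ w2; set K1 := map _ w1; set K2 := map _ w2.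
have sJK : size K1 = size J1 by rewrite !size_map.
have sJ : size (J1 ++ i :: j :: J2) = (size (J1 ++ J2)).+2.
  by rewrite !size_cat /= !addnS.
under eq_bigr do rewrite !map_cat /=.
rewrite sJ -cap_ext sJK cap_proj ?size_cat ?leq_addr //.
rewrite -(linear_tensorZ _ _ _ (proj_lin _)); congr (proj _ _ _).
by apply: funext => w; rewrite cap_ind.
Qed.

(** The value is [c a / (2 c (s b))]. It serves to show that the generator [x_ab] survives in the
    quotient. *)
Lemma haar_hyperbolic a b : haar [:: (a, b); (s a, s b)] != 0.
Proof.
have -> : haar [:: (a, b); (s a, s b)] =
    jw_coef k 0 * cup 0 (cap 0 (ind [:: b; s b])) (ext [:: a; s a]).
  by rewrite /haar /= big_ord1.
rewrite (cup_ext [::] [::]) (cap_ind [::] [::]) !eqxx !mul1r mulr1.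
apply: mulf_neq0; first exact: jw_coef_neq0.
by apply: mulf_neq0; rewrite ?invr_eq0.
Qed.

(** * Comultiplication of words, and invariance of the Haar functional *)

Fixpoint splits (w : word) : seq (word * word) :=
  if w is (i, j) :: w' then
    [seq ((i, a) :: p.1, (a, j) :: p.2) | a <- index_enum I, p <- splits w']
  else [:: ([::], [::])].

Lemma big_splits_cons (X : nmodType) (F : word -> word -> X) i j z :
  \sum_(p <- splits ((i, j) :: z)) F p.1 p.2 =
  \sum_a \sum_(p <- splits z) F ((i, a) :: p.1) ((a, j) :: p.2).
Proof. by rewrite /= big_allpairs_dep. Qed.

Lemma big_splits_cons2 (X : nmodType) (F : word -> word -> X) i j i' j' z :
  \sum_(p <- splits ((i, j) :: (i', j') :: z)) F p.1 p.2 =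
  \sum_b \sum_b' \sum_(p <- splits z)
     F ((i, b) :: (i', b') :: p.1) ((b, j) :: (b', j') :: p.2).
Proof.
rewrite big_splits_cons; apply: eq_bigr => b _.
exact: (big_splits_cons (fun p q => F ((i, b) :: p) ((b, j) :: q))).
Qed.

(** Dual form of the fact that the relations generate a two-sided ideal. *)
Lemma balanced_context phi u v :
  balanced phi -> balanced (fun z => phi (u ++ z ++ v)).
Proof.
move=> [bal1 bal2]; split=> w1 w2 i j.
  have := bal1 (u ++ w1) (w2 ++ v) i j; rewrite -!catA => <-.
  by apply: eq_bigr => a _; rewrite -!catA.
have := bal2 (u ++ w1) (w2 ++ v) i j; rewrite -!catA => <-.
by apply: eq_bigr => a _; rewrite -!catA.
Qed.

Lemma balanced_cat u phi : balanced phi -> balanced (fun z => phi (u ++ z)).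
Proof.
move/(balanced_context u [::]); under eq_fun do rewrite cats0.
by [].
Qed.

(* The [n]-th tensor power of the matrix [x], acting on the first [n] factors,
   with [phi] applied to its entries. *)
Fixpoint power_act (n : nat) (phi : word -> k) (f : tensor) : tensor := fun w =>
  if n is m.+1 then
    \sum_a power_act m (fun z => phi ((w 0, a) :: z))
                       (fun v => f (scons a v)) (stail w)
  else phi [::] * f w.

Lemma power_act_splits phi (G : seq I -> tensor) z :
  \sum_(p <- splits z)
     phi p.1 * G [seq x.2 | x <- p.2] (ext [seq x.1 | x <- p.2]) =
  power_act (size z) phi (G [seq x.2 | x <- z]) (ext [seq x.1 | x <- z]).
Proof.
elim: z phi G => [|[i j] z IHz] phi G; first by rewrite big_seq1.
rewrite (big_splits_cons (fun p q =>
  phi p * G [seq x.2 | x <- q] (ext [seq x.1 | x <- q]))) /=.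
by apply: eq_bigr => a _; exact: (IHz _ (fun J v => G (j :: J) (scons a v))).
Qed.

Lemma power_act_sum_phi (J : Type) (r : seq J) (b : J -> k) phi n f w :
  power_act n (fun z => \sum_(j <- r) b j * phi j z) f w =
  \sum_(j <- r) b j * power_act n (phi j) f w.
Proof.
elim: n phi f w => [|n IHn] phi f w /=.
  by rewrite mulr_suml; apply: eq_bigr => j _; rewrite mulrA.
under [RHS]eq_bigr do rewrite mulr_sumr.
by rewrite exchange_big; apply: eq_bigr => a _; apply: IHn.
Qed.

Lemma power_act_scale_phi b phi n f w :
  power_act n (fun z => b * phi z) f w = b * power_act n phi f w.
Proof.
have := power_act_sum_phi [:: tt] (fun=> b) (fun=> phi) n f w.
by under eq_fun do rewrite big_seq1; rewrite big_seq1.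
Qed.

Lemma power_act_lin n phi : linear (power_act n phi).
Proof.
elim: n phi => [|n IHn] phi a f g; apply: funext => w.
  rewrite -[RHS]/(a * power_act 0 phi f w + power_act 0 phi g w) /=.
  by rewrite -[(a *: f + g) _]/(a * f _ + g _) mulrDr [X in X + _]mulrCA.
rewrite -[RHS]/(a * power_act n.+1 phi f w + power_act n.+1 phi g w) /=.
rewrite mulr_sumr -big_split; apply: eq_bigr => b _ /=.
exact: (congr1 (fun h : tensor => h (stail w))
  (IHn _ a (fun v => f (scons b v)) (fun v => g (scons b v)))).
Qed.

(** The relation [x E x^T = E] says that the tensor [E], which the cup inserts, is fixed by the
    tensor square of [x]. The other relation does the same for the contraction with [E^-1]. *)
Lemma power_act_cup n i phi f : balanced phi -> (i <= n)%N ->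
  power_act n.+2 phi (cup i f) = cup i (power_act n phi f).
Proof.
elim: i n phi f => [|i IHi] n phi f bal; last first.
  case: n => // n le_in; apply: funext => w.
  rewrite -[RHS]/(cup i (fun v => power_act n.+1 phi f (scons (w 0) v)) (stail w)).
  rewrite [RHS](linear_tensor_sum _ _ _ (cup_lin i)); apply: eq_bigr => a _.
  have bal_a := balanced_cat [:: (w 0, a)] bal.
  exact: (congr1 (fun g : tensor => g (stail w))
    (IHi n _ (fun v => f (scons a v)) bal_a le_in)).
move=> _; apply: funext => w.
transitivity (\sum_a c a *
    power_act n (fun z => phi ((w 0, a) :: (w 1, s a) :: z)) f (stail (stail w))).
  rewrite /=; apply: eq_bigr => a _; rewrite (bigD1 (s a)) //= big1 => [|b].
    rewrite addr0 -(linear_tensorZ _ _ _ (power_act_lin n _)).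
    congr (power_act n _ _ _); apply: funext => v.
    by rewrite /cup /= /cup0 /= eqxx mul1r.
  move=> /negPf b_sa.
  rewrite -[RHS](mul0r (power_act n (fun z => phi ((w 0, a) :: (w 1, b) :: z)) f
    (stail (stail w)))) -(linear_tensorZ _ _ _ (power_act_lin n _)).
  congr (power_act n _ _ _); apply: funext => v.
  by rewrite /cup /= /cup0 /= b_sa mul0r.
rewrite -power_act_sum_phi.
have := bal.1 [::] _ (w 0) (w 1) => /= bal_w.
under [X in power_act _ X]eq_fun do rewrite bal_w.
exact: power_act_scale_phi.
Qed.

Lemma cap_power_act n i phi f : balanced phi -> (i <= n)%N ->
  cap i (power_act n.+2 phi f) = power_act n phi (cap i f).
Proof.
elim: i n phi f => [|i IHi] n phi f bal; last first.
  case: n => // n le_in; apply: funext => w.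
  rewrite -[LHS]/(cap i (fun v => power_act n.+3 phi f (scons (w 0) v)) (stail w)).
  rewrite [LHS](linear_tensor_sum _ _ _ (cap_lin i)); apply: eq_bigr => a _.
  have bal_a := balanced_cat [:: (w 0, a)] bal.
  exact: (congr1 (fun g : tensor => g (stail w))
    (IHi n _ (fun v => f (scons a v)) bal_a le_in)).
move=> _; apply: funext => w.
transitivity (\sum_b \sum_b' \sum_a (c (s a))^-1 *
    power_act n (fun z => phi ((a, b) :: (s a, b') :: z))
      (fun v => f (scons b (scons b' v))) w).
  rewrite /cap /= /cap0 /=; under eq_bigr do rewrite mulr_sumr.
  rewrite exchange_big; apply: eq_bigr => b _; rewrite exchange_big /=.
  under eq_bigr do rewrite mulr_sumr.
  by rewrite exchange_big.
rewrite (linear_tensor_sum _ _ _ (power_act_lin n phi)); apply: eq_bigr => b _.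
rewrite (linear_tensorZ _ _ _ (power_act_lin n phi)).
have := bal.2 [::] _ b _ => /= bal_b.
rewrite (bigD1 (s b)) //= [X in _ + X]big1 => [|b' /negPf b'_sb];
  rewrite -power_act_sum_phi; under [X in power_act _ X]eq_fun do rewrite bal_b.
  by rewrite power_act_scale_phi eqxx mul1r addr0.
by rewrite power_act_scale_phi b'_sb !mul0r.
Qed.

Lemma power_act_proj n phi f : balanced phi ->
  power_act n phi (proj n f) = phi [::] *: proj n f.
Proof.
move=> bal; apply: (intertwiner_inv_proj cap_lin cup_lin (U := power_act ^~ phi)).
- by move=> m; exact: power_act_lin.
- by [].
- by move=> m i x; exact: power_act_cup.
- by move=> m i x; exact: cap_power_act.
Qed.

(** The sum is an entry of the tensor power of [x], under [phi], composed with the projection, whose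
    values are invariant. *)
Lemma haar_invariant phi z : balanced phi ->
  \sum_(p <- splits z) phi p.1 * haar p.2 = phi [::] * haar z.
Proof.
move=> bal.
rewrite (power_act_splits phi (fun J => proj (size J) (ind J))) size_map.
by rewrite -(size_map (fun x : I * I => x.2)) power_act_proj.
Qed.

End Haar.

Arguments splits : simpl never.

(** * The Hopf algebra of a nondegenerate bilinear form *)

Section Algebra.
Local Open Scope quotient_scope.
Variables (k : fieldType) (I : finType) (s : I -> I) (c : I -> k).
Implicit Types (phi psi : word I -> k).
Local Notation balanced := (balanced s c).

Definition eval_formal phi (t : seq (k * word I)) : k :=
  \sum_(p <- t) p.1 * phi p.2.

Definition formal_eq (t u : seq (k * word I)) : bool :=
  `[< forall phi, balanced phi -> eval_formal phi t = eval_formal phi u >].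

Lemma formal_eq_refl : reflexive formal_eq.
Proof. by move=> t; apply/asboolP. Qed.

Lemma formal_eq_sym : symmetric formal_eq.
Proof. by move=> t u; apply/asboolP/asboolP => e phi /e. Qed.

Lemma formal_eq_trans : transitive formal_eq.
Proof.
move=> u t v /asboolP tu /asboolP uv; apply/asboolP => phi bal.
by rewrite tu // uv.
Qed.

Canonical formal_eq_equiv :=
  EquivRel formal_eq formal_eq_refl formal_eq_sym formal_eq_trans.

(* The quotient of the free algebra on the entries of [x] by the relations of
   [balanced]: linear functionals separate points, so a formal combination of
   words lies in the ideal iff all balanced functionals vanish on it. *)
Definition orthogonal_algebra : Type := {eq_quot formal_eq_equiv}.
Local Notation H := orthogonal_algebra.

HB.instance Definition _ := Choice.on H.
HB.instance Definition _ := EqQuotient.on H.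

Definition eval phi (x : H) : k := eval_formal phi (repr x).

Lemma eval_pi phi t : balanced phi -> eval phi (\pi_H t)%qT = eval_formal phi t.
Proof.
move=> bal.
have /eqmodP/asboolP e : (\pi_H (repr (\pi_H t)) = \pi_H t)%qT by rewrite reprK.
by rewrite /eval e.
Qed.

Lemma eval_inj (x y : H) :
  (forall phi, balanced phi -> eval phi x = eval phi y) -> x = y.
Proof. by move=> e; rewrite -(reprK x) -(reprK y); apply/eqmodP/asboolP. Qed.

Lemma eval_ext phi psi x : phi =1 psi -> eval phi x = eval psi x.
Proof. by move=> e; apply: eq_bigr => t _; rewrite e. Qed.

Lemma balanced_sum (J : Type) (r : seq J) (b : J -> k) (phi : J -> word I -> k) :
  (forall j, balanced (phi j)) ->
  balanced (fun w => \sum_(j <- r) b j * phi j w).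
Proof.
move=> bal; split=> w1 w2 i j.
all: under eq_bigr do rewrite mulr_sumr.
all: rewrite exchange_big [RHS]mulr_sumr; apply: eq_bigr => l _ /=.
all: under eq_bigr do rewrite mulrCA.
  by rewrite -mulr_sumr (bal l).1 mulrCA.
by rewrite -mulr_sumr (bal l).2 mulrCA.
Qed.

Lemma balanced_cat_r v phi : balanced phi -> balanced (fun z => phi (z ++ v)).
Proof. exact: (balanced_context [::] v). Qed.

Lemma balanced_eval_l phi (y : H) : balanced phi ->
  balanced (fun w => eval (fun w' => phi (w ++ w')) y).
Proof. by move=> bal; apply: balanced_sum => t; exact: balanced_cat_r. Qed.

Lemma balanced_eval_r phi (x : H) : balanced phi ->
  balanced (fun w' => eval (fun w => phi (w ++ w')) x).
Proof. by move=> bal; apply: balanced_sum => t; exact: balanced_cat. Qed.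

Lemma eval_exchange (F : word I -> word I -> k) (x y : H) :
  eval (fun w => eval (F w) y) x = eval (fun w' => eval (F^~ w') x) y.
Proof.
rewrite /eval /eval_formal; under eq_bigr do rewrite mulr_sumr.
rewrite exchange_big; apply: eq_bigr => t _; rewrite mulr_sumr.
by apply: eq_bigr => u _; rewrite mulrCA.
Qed.

Definition counit_word (w : word I) : k := (all (fun x => x.1 == x.2) w)%:R.

Lemma balanced_counit : balanced counit_word.
Proof.
split=> w1 w2 i j; rewrite /counit_word.
  rewrite (bigD1 i) //= big1 => [|a /negPf ai].
    rewrite !all_cat /= eqxx addr0 mulrC.
    by case: eqP; rewrite ?andbF ?mul0r ?mul1r // mulrC.
  by rewrite all_cat /= eq_sym ai andbF mulr0.
rewrite (bigD1 i) //= big1 => [|a /negPf ai].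
  rewrite !all_cat /= eqxx addr0 mulrC eq_sym.
  by case: eqP; rewrite ?andbF ?mul0r ?mul1r // mulrC.
by rewrite all_cat /= ai andbF mulr0.
Qed.

Definition oalg_zero : H := (\pi_H [::])%qT.
Definition oalg_add (x y : H) : H := (\pi_H (repr x ++ repr y))%qT.
Definition oalg_scale (a : k) (x : H) : H :=
  (\pi_H [seq (a * t.1, t.2) | t <- repr x])%qT.
Definition oalg_opp (x : H) : H := oalg_scale (-1) x.
Definition oalg_one : H := (\pi_H [:: (1, [::])])%qT.
Definition oalg_mul (x y : H) : H :=
  (\pi_H [seq (t.1 * u.1, t.2 ++ u.2) | t <- repr x, u <- repr y])%qT.

Section Operations.
Variable phi : word I -> k.
Hypothesis bal : balanced phi.

Lemma eval0 : eval phi oalg_zero = 0.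
Proof. by rewrite eval_pi // /eval_formal big_nil. Qed.

Lemma evalD x y : eval phi (oalg_add x y) = eval phi x + eval phi y.
Proof. by rewrite eval_pi // /eval_formal big_cat. Qed.

Lemma evalZ a x : eval phi (oalg_scale a x) = a * eval phi x.
Proof.
rewrite eval_pi // /eval_formal big_map mulr_sumr.
by apply: eq_bigr => t _; rewrite mulrA.
Qed.

Lemma evalN x : eval phi (oalg_opp x) = - eval phi x.
Proof. by rewrite evalZ mulN1r. Qed.

Lemma eval1 : eval phi oalg_one = phi [::].
Proof. by rewrite eval_pi // /eval_formal big_seq1 mul1r. Qed.

Lemma evalM x y :
  eval phi (oalg_mul x y) = eval (fun w => eval (fun w' => phi (w ++ w')) y) x.
Proof.
rewrite eval_pi // /eval /eval_formal big_allpairs_dep; apply: eq_bigr => t _.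
by rewrite mulr_sumr; apply: eq_bigr => u _; rewrite mulrA.
Qed.

(** The order of nesting decides which factor is outermost: this one suits laws that are linear in
    the second factor. *)
Lemma evalM' x y :
  eval phi (oalg_mul x y) = eval (fun w' => eval (fun w => phi (w ++ w')) x) y.
Proof. by rewrite evalM eval_exchange. Qed.

End Operations.

Lemma oalg_addA : associative oalg_add.
Proof. by move=> x y z; apply: eval_inj => phi bal; rewrite !evalD // addrA. Qed.

Lemma oalg_addC : commutative oalg_add.
Proof. by move=> x y; apply: eval_inj => phi bal; rewrite !evalD // addrC. Qed.

Lemma oalg_add0 : left_id oalg_zero oalg_add.
Proof. by move=> x; apply: eval_inj => phi bal; rewrite evalD // eval0 // add0r. Qed.

Lemma oalg_addN : left_inverse oalg_zero oalg_opp oalg_add.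
Proof.
by move=> x; apply: eval_inj => phi bal; rewrite evalD // evalN // eval0 // addNr.
Qed.

HB.instance Definition _ :=
  GRing.isZmodule.Build H oalg_addA oalg_addC oalg_add0 oalg_addN.

Lemma oalg_mulA : associative oalg_mul.
Proof.
move=> x y z; apply: eval_inj => phi bal; rewrite evalM // [RHS]evalM //.
rewrite evalM; last exact: balanced_eval_l.
apply: eval_ext => w; rewrite evalM; last exact: balanced_cat.
by apply: eval_ext => w'; apply: eval_ext => w''; rewrite catA.
Qed.

Lemma oalg_mul1l : left_id oalg_one oalg_mul.
Proof.
move=> x; apply: eval_inj => phi bal; rewrite evalM // eval1 //.
exact: balanced_eval_l.
Qed.

Lemma oalg_mul1r : right_id oalg_one oalg_mul.
Proof.
move=> x; apply: eval_inj => phi bal; rewrite evalM' // eval1 //.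
  by apply: eval_ext => w; rewrite cats0.
exact: balanced_eval_r.
Qed.

Lemma oalg_mulDl : left_distributive oalg_mul oalg_add.
Proof.
move=> x y z; apply: eval_inj => phi bal; rewrite evalD // !evalM // evalD //.
exact: balanced_eval_l.
Qed.

Lemma oalg_mulDr : right_distributive oalg_mul oalg_add.
Proof.
move=> x y z; apply: eval_inj => phi bal; rewrite evalD // !evalM' // evalD //.
exact: balanced_eval_r.
Qed.

Lemma oalg_one_neq0 : oalg_one != oalg_zero.
Proof.
apply/eqP => /(congr1 (eval counit_word)) /eqP.
by rewrite eval1 ?eval0 ?oner_eq0 //; exact: balanced_counit.
Qed.

HB.instance Definition _ := GRing.Zmodule_isNzRing.Build H
  oalg_mulA oalg_mul1l oalg_mul1r oalg_mulDl oalg_mulDr oalg_one_neq0.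

Lemma oalg_scaleA a b x : oalg_scale a (oalg_scale b x) = oalg_scale (a * b) x.
Proof. by apply: eval_inj => phi bal; rewrite !evalZ // mulrA. Qed.

Lemma oalg_scale1 : left_id 1 oalg_scale.
Proof. by move=> x; apply: eval_inj => phi bal; rewrite evalZ // mul1r. Qed.

Lemma oalg_scaleDr : right_distributive oalg_scale +%R.
Proof.
by move=> a x y; apply: eval_inj => phi bal; rewrite !(evalZ, evalD) // mulrDr.
Qed.

Lemma oalg_scaleDl x : {morph oalg_scale^~ x : a b / a + b}.
Proof.
by move=> a b; apply: eval_inj => phi bal; rewrite !(evalZ, evalD) // mulrDl.
Qed.

HB.instance Definition _ := GRing.Zmodule_isLmodule.Build k H
  oalg_scaleA oalg_scale1 oalg_scaleDr oalg_scaleDl.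

Lemma oalg_scaleAl (a : k) (x y : H) : a *: (x * y) = (a *: x) * y.
Proof.
apply: eval_inj => phi bal; rewrite evalZ // !evalM // evalZ //.
exact: balanced_eval_l.
Qed.

HB.instance Definition _ := GRing.Lmodule_isLalgebra.Build k H oalg_scaleAl.

Lemma oalg_scaleAr (a : k) (x y : H) : a *: (x * y) = x * (a *: y).
Proof.
apply: eval_inj => phi bal; rewrite evalZ // !evalM' // evalZ //.
exact: balanced_eval_r.
Qed.

HB.instance Definition _ := GRing.Lalgebra_isAlgebra.Build k H oalg_scaleAr.

End Algebra.

(** * Hopf algebra identities at the level of words *)

Section Words.
Variables (k : fieldType) (I : finType) (s : I -> I) (c : I -> k).
Implicit Types (phi : word I -> k) (F : word I -> word I -> k) (w z : word I).
Local Notation balanced := (balanced s c).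

Lemma big_splits_cat (X : nmodType) (F : word I -> word I -> X) w z :
  \sum_(p <- splits (w ++ z)) F p.1 p.2 =
  \sum_(p <- splits w) \sum_(q <- splits z) F (p.1 ++ q.1) (p.2 ++ q.2).
Proof.
elim: w F => [|[i j] w IHw] F; first by rewrite big_seq1.
rewrite cat_cons big_splits_cons (big_splits_cons (fun u v =>
  \sum_(q <- splits z) F (u ++ q.1) (v ++ q.2))).
apply: eq_bigr => a _.
exact: (IHw (fun p q => F ((i, a) :: p) ((a, j) :: q))).
Qed.

Lemma big_splits_assoc (X : nmodType) (F : word I -> word I -> word I -> X) w :
  \sum_(p <- splits w) \sum_(q <- splits p.1) F q.1 q.2 p.2 =
  \sum_(p <- splits w) \sum_(q <- splits p.2) F p.1 q.1 q.2.
Proof.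
elim: w F => [|[i j] w IHw] F; first by rewrite !big_seq1.
rewrite (big_splits_cons (fun u v => \sum_(q <- splits u) F q.1 q.2 v)).
rewrite (big_splits_cons (fun u v => \sum_(q <- splits v) F u q.1 q.2)).
under eq_bigr do under eq_bigr do
  rewrite (big_splits_cons (fun u v => F u v (_ :: _))).
under [RHS]eq_bigr do under eq_bigr do
  rewrite (big_splits_cons (fun u v => F (_ :: _) u v)).
under eq_bigr do rewrite exchange_big.
under [RHS]eq_bigr do rewrite exchange_big.
rewrite exchange_big; apply: eq_bigr => b _; apply: eq_bigr => a _.
exact: (IHw (fun p q r => F ((i, b) :: p) ((b, a) :: q) ((a, j) :: r))).
Qed.

(** This makes the comultiplication well defined. For [x E x^T = E] the contraction collapses the
    second tensor leg to an [E] between the legs, which then collapses the first; for the other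
    relation the legs collapse in the opposite order. *)
Lemma balanced_splits F :
  (forall q, balanced (F^~ q)) -> (forall p, balanced (F p)) ->
  balanced (fun w => \sum_(p <- splits w) F p.1 p.2).
Proof.
move=> balL balR; split=> w1 w2 i j.
  elim: w1 F balL balR => [|[x y] w1 IHw] F balL balR; last first.
    under eq_bigr do rewrite cat_cons big_splits_cons mulr_sumr.
    rewrite exchange_big cat_cons big_splits_cons mulr_sumr; apply: eq_bigr => b _.
    apply: (IHw (fun p q => F ((x, b) :: p) ((b, y) :: q))) => [q|p].
      exact: (balanced_cat [:: _] (balL _)).
    exact: (balanced_cat [:: _] (balR _)).
  transitivity (\sum_b \sum_b' \sum_(p <- splits w2) \sum_a
     c a * F ((i, b) :: (j, b') :: p.1) ((b, a) :: (b', s a) :: p.2)).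
    under eq_bigr do rewrite big_splits_cons2 mulr_sumr.
    rewrite exchange_big; apply: eq_bigr => b _.
    under eq_bigr do rewrite mulr_sumr.
    rewrite exchange_big; apply: eq_bigr => b' _.
    by under eq_bigr do rewrite mulr_sumr; rewrite exchange_big.
  transitivity (\sum_b \sum_(p <- splits w2)
      c b * F ((i, b) :: (j, s b) :: p.1) p.2).
    apply: eq_bigr => b _; rewrite (bigD1 (s b)) //= [X in _ + X]big1.
      rewrite addr0; apply: eq_bigr => p _.
      by have := (balR ((i, b) :: (j, s b) :: p.1)).1 [::] p.2 b (s b) => /= ->;
        rewrite eqxx mul1r.
    move=> b' /negPf nb; apply: big1 => p _.
    by have := (balR ((i, b) :: (j, b') :: p.1)).1 [::] p.2 b b' => /= ->;
      rewrite nb !mul0r.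
  rewrite exchange_big mulr_sumr; apply: eq_bigr => p _.
  exact: ((balL p.2).1 [::]).
elim: w1 F balL balR => [|[x y] w1 IHw] F balL balR; last first.
  under eq_bigr do rewrite cat_cons big_splits_cons mulr_sumr.
  rewrite exchange_big cat_cons big_splits_cons mulr_sumr; apply: eq_bigr => b _.
  apply: (IHw (fun p q => F ((x, b) :: p) ((b, y) :: q))) => [q|p].
    exact: (balanced_cat [:: _] (balL _)).
  exact: (balanced_cat [:: _] (balR _)).
transitivity (\sum_b \sum_b' \sum_(p <- splits w2) \sum_a
   (c (s a))^-1 * F ((a, b) :: (s a, b') :: p.1) ((b, i) :: (b', j) :: p.2)).
  under eq_bigr do rewrite big_splits_cons2 mulr_sumr.
  rewrite exchange_big; apply: eq_bigr => b _.
  under eq_bigr do rewrite mulr_sumr.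
  rewrite exchange_big; apply: eq_bigr => b' _.
  by under eq_bigr do rewrite mulr_sumr; rewrite exchange_big.
transitivity (\sum_b \sum_(p <- splits w2)
    (c (s b))^-1 * F p.1 ((b, i) :: (s b, j) :: p.2)).
  apply: eq_bigr => b _; rewrite (bigD1 (s b)) //= [X in _ + X]big1.
    rewrite addr0; apply: eq_bigr => p _.
    by have := (balL ((b, i) :: (s b, j) :: p.2)).2 [::] p.1 b (s b) => /= ->;
      rewrite eqxx mul1r.
  move=> b' /negPf nb; apply: big1 => p _.
  by have := (balL ((b, i) :: (b', j) :: p.2)).2 [::] p.1 b b' => /= ->;
    rewrite nb !mul0r.
rewrite exchange_big mulr_sumr; apply: eq_bigr => p _.
exact: ((balR p.1).2 [::]).
Qed.

Local Notation counit_word := (@counit_word k I).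

Lemma counit_word_cons i j w : counit_word ((i, j) :: w) = (i == j)%:R * counit_word w.
Proof. by rewrite /counit_word /=; case: eqP; rewrite ?mul1r ?mul0r. Qed.

Lemma counit_word_cat w z : counit_word (w ++ z) = counit_word w * counit_word z.
Proof. by rewrite /counit_word all_cat; case: all; rewrite ?mul1r ?mul0r. Qed.

Lemma splits_counit_left phi w :
  \sum_(p <- splits w) counit_word p.1 * phi p.2 = phi w.
Proof.
elim: w phi => [|[i j] w IHw] phi; first by rewrite big_seq1 mul1r.
rewrite (big_splits_cons (fun p q => counit_word p * phi q)).
under eq_bigr do under eq_bigr do rewrite counit_word_cons -mulrA.
under eq_bigr do rewrite -mulr_sumr (IHw (fun z => phi (_ :: z))).
rewrite (bigD1 i) //= big1 => [|a]; first by rewrite eqxx mul1r addr0.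
by rewrite eq_sym => /negPf ->; rewrite mul0r.
Qed.

Lemma splits_counit_right phi w :
  \sum_(p <- splits w) counit_word p.2 * phi p.1 = phi w.
Proof.
elim: w phi => [|[i j] w IHw] phi; first by rewrite big_seq1 mul1r.
rewrite (big_splits_cons (fun p q => counit_word q * phi p)).
under eq_bigr do under eq_bigr do rewrite counit_word_cons -mulrA.
under eq_bigr do rewrite -mulr_sumr (IHw (fun z => phi (_ :: z))).
rewrite (bigD1 j) //= big1 => [|a]; first by rewrite eqxx mul1r addr0.
by move=> /negPf ->; rewrite mul0r.
Qed.

(** From [x E x^T = E] the inverse of [x] is [E x^T E^-1], so [S(x_ij) = (c i / c j) x_(s j)(s i)];
    the scalar is kept apart in [anti_coef]. *)
Definition anti_letter (x : I * I) : I * I := (s x.2, s x.1).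
Definition anti_word w : word I := rev (map anti_letter w).
Definition anti_coef w : k := \prod_(x <- w) (c x.1 / c x.2).

Lemma anti_word_cons x w : anti_word (x :: w) = rcons (anti_word w) (anti_letter x).
Proof. by rewrite /anti_word /= rev_cons. Qed.

Lemma anti_word_cat w z : anti_word (w ++ z) = anti_word z ++ anti_word w.
Proof. by rewrite /anti_word map_cat rev_cat. Qed.

Lemma anti_coef_cons x w : anti_coef (x :: w) = c x.1 / c x.2 * anti_coef w.
Proof. exact: big_cons. Qed.

Lemma anti_coef_cat w z : anti_coef (w ++ z) = anti_coef w * anti_coef z.
Proof. exact: big_cat. Qed.

Hypothesis sK : involutive s.
Hypothesis c_neq0 : forall a, c a != 0.

(** Transposing the matrix and reversing products exchanges the two families of relations, so each
    is obtained from the other. *)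
Lemma balanced_antipode phi : balanced phi ->
  balanced (fun w => anti_coef w * phi (anti_word w)).
Proof.
move=> [bal1 bal2].
have anti_mid x y w1 w2 : anti_word (w1 ++ x :: y :: w2) =
    anti_word w2 ++ anti_letter y :: anti_letter x :: anti_word w1.
  by rewrite anti_word_cat !anti_word_cons -!cats1 -!catA.
split=> w1 w2 i j.
  under eq_bigr => a _.
    rewrite anti_mid /anti_letter /= sK anti_coef_cat !anti_coef_cons /=.
    rewrite (_ : c a * _ = (c i * c j * (anti_coef w1 * anti_coef w2)) *
      ((c (s a))^-1 * phi (anti_word w2 ++ (a, s j) :: (s a, s i) :: anti_word w1)));
      last by field; rewrite !c_neq0.
    over.
  rewrite -mulr_sumr bal2 anti_coef_cat anti_word_cat sK.
  rewrite [s i == j]eq_sym.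
  by case: eqP => _; rewrite ?mul0r ?mulr0 //; field; rewrite c_neq0.
under eq_bigr => a _.
  rewrite anti_mid /anti_letter /= sK anti_coef_cat !anti_coef_cons /=.
  rewrite (_ : _ * _ = ((c i * c j)^-1 * (anti_coef w1 * anti_coef w2)) *
    (c a * phi (anti_word w2 ++ (s j, a) :: (s i, s a) :: anti_word w1)));
    last by field; rewrite !c_neq0.
  over.
rewrite -mulr_sumr bal1 anti_coef_cat anti_word_cat sK.
rewrite [s i == j]eq_sym; have [->|_] := eqVneq j (s i); last by rewrite !mul0r mulr0.
by rewrite sK; field; rewrite !c_neq0.
Qed.

Lemma splits_antipode_left phi w : balanced phi ->
  \sum_(p <- splits w) anti_coef p.1 * phi (anti_word p.1 ++ p.2) =
  counit_word w * phi [::].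
Proof.
move=> bal; elim: w => [|[i j] w IHw].
  by rewrite big_seq1 /anti_coef big_nil.
rewrite (big_splits_cons (fun p q => anti_coef p * phi (anti_word p ++ q))).
rewrite exchange_big counit_word_cons -mulrA -IHw mulr_sumr; apply: eq_bigr => p _.
rewrite (reindex_inj (can_inj sK)) /=.
under eq_bigr => b _.
  rewrite anti_coef_cons anti_word_cons cat_rcons /anti_letter /= sK.
  rewrite (_ : _ * _ = c i * anti_coef p.1 * ((c (s b))^-1 *
    phi (anti_word p.1 ++ (b, s i) :: (s b, j) :: p.2))); last by ring.
  over.
rewrite -mulr_sumr bal.2 sK [j == i]eq_sym.
by case: eqP => _; rewrite ?mul0r ?mulr0 //; field.
Qed.

Lemma splits_antipode_right phi w : balanced phi ->
  \sum_(p <- splits w) anti_coef p.2 * phi (p.1 ++ anti_word p.2) =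
  counit_word w * phi [::].
Proof.
elim: w phi => [|[i j] w IHw] phi bal.
  by rewrite big_seq1 /anti_coef big_nil.
rewrite (big_splits_cons (fun p q => anti_coef q * phi (p ++ anti_word q))).
(* Here the new letters enclose the old product, so the induction hypothesis is applied first, to
   [phi] with [(i, a)] in front and [(s j, s a)] behind; only then do the two letters meet. *)
transitivity (\sum_a c a * (counit_word w / c j * phi [:: (i, a); (s j, s a)])).
  apply: eq_bigr => a _.
  have := IHw _ (balanced_context [:: (i, a)] [:: (s j, s a)] bal) => /= IHa.
  rewrite (_ : _ * _ = c a / c j * (counit_word w * phi [:: (i, a); (s j, s a)]));
    last by field.
  rewrite -IHa mulr_sumr; apply: eq_bigr => p _.
  by rewrite anti_coef_cons anti_word_cons -cats1 -mulrA /= catA.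
under eq_bigr do rewrite mulrCA.
rewrite -mulr_sumr; have := bal.1 [::] [::] i (s j) => /= ->.
rewrite counit_word_cons (inj_eq (can_inj sK)) [j == i]eq_sym.
by case: eqP => [->|_]; rewrite ?mul0r ?mulr0 //; field.
Qed.

Lemma anti_coef_splits F w :
  \sum_(p <- splits w) anti_coef p.1 * anti_coef p.2 * F p.1 p.2 =
  anti_coef w * \sum_(p <- splits w) F p.1 p.2.
Proof.
elim: w F => [|[i j] w IHw] F.
  by rewrite !big_seq1 /anti_coef !big_nil mulr1.
rewrite (big_splits_cons (fun p q => anti_coef p * anti_coef q * F p q)).
rewrite (big_splits_cons F) mulr_sumr; apply: eq_bigr => a _.
rewrite anti_coef_cons -mulrA -(IHw (fun p q => F ((i, a) :: p) ((a, j) :: q))) mulr_sumr.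
apply: eq_bigr => p _.
by rewrite !anti_coef_cons /=; field; rewrite !c_neq0.
Qed.

Lemma splits_anti_word (X : nmodType) (F : word I -> word I -> X) w :
  \sum_(p <- splits (anti_word w)) F p.1 p.2 =
  \sum_(p <- splits w) F (anti_word p.2) (anti_word p.1).
Proof.
elim: w F => [|[i j] w IHw] F; first by rewrite !big_seq1.
rewrite anti_word_cons -cats1 big_splits_cat.
rewrite (IHw (fun u v =>
  \sum_(q <- splits [:: anti_letter (i, j)]) F (u ++ q.1) (v ++ q.2))).
rewrite (big_splits_cons (fun u v => F (anti_word v) (anti_word u))) [RHS]exchange_big.
apply: eq_bigr => p _.
rewrite (big_splits_cons (fun u v => F (anti_word p.2 ++ u) (anti_word p.1 ++ v))).
rewrite (reindex_inj (can_inj sK)); apply: eq_bigr => a _.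
by rewrite big_seq1 !anti_word_cons -!cats1.
Qed.

Section Integral.
Variable lam : word I -> k.
Hypothesis lam_inv : forall phi z, balanced phi ->
  \sum_(p <- splits z) phi p.1 * lam p.2 = phi [::] * lam z.

(** In Sweedler notation, [h_1 lam(h_2 S(g)) = h_1 S(g_2) g_3 lam(h_2 S(g_1))], and as [S] reverses
    the coproduct this is [(h S(g_1))_1 g_2 lam((h S(g_1))_2) = lam(h S(g_1)) g_2]. *)
Lemma integral_antipode phi h g : balanced phi ->
  \sum_(p <- splits h) phi p.1 * (anti_coef g * lam (p.2 ++ anti_word g)) =
  \sum_(p <- splits g) anti_coef p.1 * lam (h ++ anti_word p.1) * phi p.2.
Proof.
move=> bal.
transitivity (\sum_(y <- splits h) \sum_(x <- splits g) \sum_(z <- splits x.2)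
   anti_coef x.1 * lam (y.2 ++ anti_word x.1) *
   (anti_coef z.1 * phi (y.1 ++ anti_word z.1 ++ z.2))).
  apply: eq_bigr => y _.
  under eq_bigr => x _.
    rewrite -mulr_sumr (splits_antipode_left _ (balanced_cat y.1 bal)) cats0.
    rewrite mulrCA; over.
  rewrite (splits_counit_right
    (fun u => anti_coef u * lam (y.2 ++ anti_word u) * phi y.1)).
  by rewrite mulrC.
rewrite exchange_big /=.
transitivity (\sum_(x <- splits g) anti_coef x.1 *
   \sum_(p <- splits (h ++ anti_word x.1)) phi (p.1 ++ x.2) * lam p.2); last first.
  apply: eq_bigr => x _.
  rewrite (lam_inv _ (balanced_cat_r x.2 bal)) /=.
  by rewrite -mulrA [lam _ * _]mulrC.
rewrite exchange_big /=.
under eq_bigr do rewrite -(big_splits_assoc (fun u v t =>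
   anti_coef u * lam (_ ++ anti_word u) * (anti_coef v * phi (_ ++ anti_word v ++ t)))).
rewrite exchange_big; apply: eq_bigr => x _ /=.
rewrite (big_splits_cat (fun u v => phi (u ++ x.2) * lam v)) mulr_sumr.
apply: eq_bigr => y _.
rewrite (splits_anti_word (fun u v => phi ((y.1 ++ u) ++ x.2) * lam (y.2 ++ v))).
rewrite -(anti_coef_splits (fun u v =>
  phi ((y.1 ++ anti_word v) ++ x.2) * lam (y.2 ++ anti_word u))).
by apply: eq_bigr => z _; rewrite -catA; ring.
Qed.

End Integral.

End Words.

(** * The Hopf algebra structure on the quotient *)

Section HopfStructure.
Variables (k : fieldType) (I : finType) (s : I -> I) (c : I -> k).
Local Notation H := (orthogonal_algebra s c).
Local Notation balanced := (balanced s c).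
Local Notation counit_word := (@counit_word k I).
Local Notation anti_word := (anti_word s).
Local Notation anti_coef := (anti_coef c).
Implicit Types (phi : word I -> k) (w z : word I).

Definition cls w : H := (\pi_H [:: (1, w)])%qT.

Lemma eval_cls phi w : balanced phi -> eval phi (cls w) = phi w.
Proof. by move=> bal; rewrite eval_pi // /eval_formal big_seq1 mul1r. Qed.

Lemma eval_scalar phi : balanced phi -> scalar (@eval k I s c phi).
Proof. by move=> bal a x y; rewrite evalD // evalZ. Qed.

Lemma eval_sum phi (J : Type) (r : seq J) (F : J -> H) : balanced phi ->
  eval phi (\sum_(j <- r) F j) = \sum_(j <- r) eval phi (F j).
Proof. by move/eval_scalar => l; exact: (linear_map_sum (scalar_linear l)). Qed.

Lemma cls_cat w z : cls (w ++ z) = cls w * cls z.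
Proof.
apply: eval_inj => phi bal; rewrite evalM // !eval_cls //.
  exact: balanced_cat.
exact: balanced_eval_l.
Qed.

Lemma cls_nil : cls [::] = 1.
Proof. by []. Qed.

Lemma cls_decomp (x : H) : x = \sum_(t <- repr x) t.1 *: cls t.2.
Proof.
apply: eval_inj => phi bal; rewrite eval_sum //; apply: eq_bigr => t _.
by rewrite evalZ // eval_cls.
Qed.

Lemma linear_cls_ext (X : lmodType k) (f g : H -> X) :
  linear f -> linear g -> (forall w, f (cls w) = g (cls w)) -> f =1 g.
Proof.
move=> lf lg fg x; rewrite (cls_decomp x) (linear_map_sum lf) (linear_map_sum lg).
by apply: eq_bigr => t _; rewrite (linear_mapZ lf) (linear_mapZ lg) fg.
Qed.

Lemma scalar_cls_ext (L M : H -> k) :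
  scalar L -> scalar M -> (forall w, L (cls w) = M (cls w)) -> L =1 M.
Proof. by move=> /scalar_linear lL /scalar_linear lM; exact: (linear_cls_ext lL lM). Qed.

(** With [eval_scalar] this identifies the dual of the algebra with the balanced functions. *)
Lemma balanced_functional (L : H -> k) : scalar L -> balanced (fun w => L (cls w)).
Proof.
move/scalar_linear => lL; split=> w1 w2 i j.
all: under eq_bigr do rewrite -[_ * _](linear_mapZ lL).
all: rewrite -[_ * L _](linear_mapZ lL) -(linear_map_sum lL); congr L.
all: apply: eval_inj => phi bal; rewrite eval_sum // evalZ // eval_cls //.
all: under eq_bigr do rewrite evalZ // eval_cls //.
  exact: bal.1.
exact: bal.2.
Qed.

(** The list depends on the chosen representative of [x], but the tensor does not:
    [balanced_comul_form] shows that forms cannot tell representatives apart. *)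
Definition oalg_comul (x : H) : seq (H * H) :=
  [seq (t.1 *: cls p.1, cls p.2) | t <- repr x, p <- splits t.2].

Definition oalg_counit (x : H) : k := eval counit_word x.

Definition oalg_antipode (x : H) : H :=
  \sum_(t <- repr x) (t.1 * anti_coef t.2) *: cls (anti_word t.2).

Definition oalg_hopf : hopf_data H :=
  HopfData oalg_comul oalg_counit oalg_antipode.

Section BilinearForms.
Variable f : H -> H -> k.
Hypothesis bf : bilinear_form f.

Lemma balanced_comul_form :
  balanced (fun w => \sum_(p <- splits w) f (cls p.1) (cls p.2)).
Proof.
case: bf => f1 f2.
apply: (balanced_splits (F := fun p q => f (cls p) (cls q))) => q.
  by apply: (balanced_functional (L := f^~ (cls q))) => a x y; exact: f2.
by apply: (balanced_functional (L := f (cls q))) => a x y; exact: f1.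
Qed.

Lemma comul_formE x : \sum_(p <- oalg_comul x) f p.1 p.2 =
  eval (fun w => \sum_(p <- splits w) f (cls p.1) (cls p.2)) x.
Proof.
rewrite /oalg_comul big_allpairs_dep; apply: eq_bigr => t _.
rewrite mulr_sumr; apply: eq_bigr => p _.
exact: (linear_mapZ ((bilinear_form_map bf).2 _)).
Qed.

Lemma comul_form_cls w : \sum_(p <- oalg_comul (cls w)) f p.1 p.2 =
  \sum_(p <- splits w) f (cls p.1) (cls p.2).
Proof. by rewrite comul_formE eval_cls //; exact: balanced_comul_form. Qed.

Lemma comul_form_scalar : scalar (fun x => \sum_(p <- oalg_comul x) f p.1 p.2).
Proof.
by move=> a x y; rewrite !comul_formE (eval_scalar balanced_comul_form).
Qed.

End BilinearForms.

Lemma oalg_counit_scalar : scalar oalg_counit.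
Proof. exact/eval_scalar/balanced_counit. Qed.

Lemma oalg_counit_cls w : oalg_counit (cls w) = counit_word w.
Proof. exact/eval_cls/balanced_counit. Qed.

Hypothesis sK : involutive s.
Hypothesis c_neq0 : forall a, c a != 0.

Lemma eval_antipode phi x : balanced phi -> eval phi (oalg_antipode x) =
  eval (fun w => anti_coef w * phi (anti_word w)) x.
Proof.
move=> bal; rewrite eval_sum //; apply: eq_bigr => t _.
by rewrite evalZ // eval_cls // mulrA.
Qed.

Lemma oalg_antipode_linear : linear oalg_antipode.
Proof.
move=> a x y; apply: eval_inj => phi bal.
rewrite (eval_scalar bal) !eval_antipode //.
by rewrite (eval_scalar (balanced_antipode sK c_neq0 bal)).
Qed.

Lemma oalg_antipode_cls w :
  oalg_antipode (cls w) = anti_coef w *: cls (anti_word w).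
Proof.
apply: eval_inj => phi bal; rewrite eval_antipode // evalZ // !eval_cls //.
exact: balanced_antipode.
Qed.

Lemma mul_linear_l (y : H) : linear (fun x : H => x * y).
Proof. by move=> a x x'; rewrite mulrDl scalerAl. Qed.

Lemma mul_linear_r (y : H) : linear (fun x : H => y * x).
Proof. by move=> a x x'; rewrite mulrDr scalerAr. Qed.

Lemma form_linear_l (f : H -> H -> k) : bilinear_form f ->
  forall a u u' v, f (a *: u + u') v = a * f u v + f u' v.
Proof. by case=> _ f2 a u u' v; exact: f2. Qed.

Lemma form_linear_r (f : H -> H -> k) : bilinear_form f ->
  forall a u v v', f u (a *: v + v') = a * f u v + f u v'.
Proof. by case=> f1 _ a u v v'; exact: f1. Qed.

Lemma sum_lin (J : Type) (r : seq J) (F G : J -> k) a :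
  \sum_(j <- r) (a * F j + G j) = a * \sum_(j <- r) F j + \sum_(j <- r) G j.
Proof. by rewrite big_split mulr_sumr. Qed.

Lemma oalg_comul_linear a x y :
  teq2 (oalg_comul (a *: x + y))
       ([seq (a *: p.1, p.2) | p <- oalg_comul x] ++ oalg_comul y).
Proof.
move=> f bf; rewrite (comul_form_scalar bf) big_cat big_map /= mulr_sumr.
congr (_ + _); apply: eq_bigr => p _.
exact: (esym (linear_mapZ ((bilinear_form_map bf).2 p.2) a p.1)).
Qed.

Lemma oalg_coassoc h :
  teq3 [seq (q.1, q.2, p.2) | p <- oalg_comul h, q <- oalg_comul p.1]
       [seq (p.1, q.1, q.2) | p <- oalg_comul h, q <- oalg_comul p.2].
Proof.
move=> f [f1 [f2 f3]]; rewrite big_allpairs_dep [RHS]big_allpairs_dep /=.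
have bf1 v : bilinear_form (fun u u' => f u u' v) by split=> *; rewrite ?f1 ?f2.
have bf2 u : bilinear_form (f u) by split=> *; rewrite ?f2 ?f3.
have bg1 : bilinear_form (fun u v => \sum_(q <- oalg_comul u) f q.1 q.2 v).
  split=> [u a v v'|v a u u']; last exact: (comul_form_scalar (bf1 v)).
  by rewrite -sum_lin; apply: eq_bigr => q _; rewrite f3.
have bg2 : bilinear_form (fun u v => \sum_(q <- oalg_comul v) f u q.1 q.2).
  split=> [u a v v'|v a u u']; first exact: (comul_form_scalar (bf2 u)).
  by rewrite -sum_lin; apply: eq_bigr => q _; rewrite f1.
apply: (scalar_cls_ext (comul_form_scalar bg1) (comul_form_scalar bg2) _ h) => w.
rewrite (comul_form_cls bg1) (comul_form_cls bg2).
under eq_bigr do rewrite (comul_form_cls (bf1 _)).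
under [RHS]eq_bigr do rewrite (comul_form_cls (bf2 _)).
exact: (big_splits_assoc (fun u v t => f (cls u) (cls v) (cls t))).
Qed.

Lemma oalg_counit_left h : \sum_(p <- oalg_comul h) oalg_counit p.1 *: p.2 = h.
Proof.
apply: eval_inj => phi bal; rewrite eval_sum //.
under eq_bigr do rewrite evalZ //.
rewrite (comul_formE (f := fun u v => oalg_counit u * eval phi v)).
  apply: eval_ext => w; rewrite -[RHS]splits_counit_left; apply: eq_bigr => p _.
  by rewrite oalg_counit_cls eval_cls.
split=> [u a v v'|v a u u']; first by rewrite (eval_scalar bal) mulrDr mulrCA.
by rewrite oalg_counit_scalar mulrDl mulrA.
Qed.

Lemma oalg_counit_right h : \sum_(p <- oalg_comul h) oalg_counit p.2 *: p.1 = h.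
Proof.
apply: eval_inj => phi bal; rewrite eval_sum //.
under eq_bigr do rewrite evalZ //.
rewrite (comul_formE (f := fun u v => oalg_counit v * eval phi u)).
  apply: eval_ext => w; rewrite -[RHS]splits_counit_right; apply: eq_bigr => p _.
  by rewrite oalg_counit_cls eval_cls.
split=> [u a v v'|v a u u']; last by rewrite (eval_scalar bal) mulrDr mulrCA.
by rewrite oalg_counit_scalar mulrDl mulrA.
Qed.

Lemma oalg_comul_mul x y :
  teq2 (oalg_comul (x * y))
       [seq (p.1 * q.1, p.2 * q.2) | p <- oalg_comul x, q <- oalg_comul y].
Proof.
move=> f bf; rewrite [RHS]big_allpairs_dep /=.
have fl := form_linear_l bf; have fr := form_linear_r bf.
have bfl (q : H * H) : bilinear_form (fun u v => f (u * q.1) (v * q.2)).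
  by split=> *; rewrite mul_linear_l ?fl ?fr.
have bfr (p : H * H) : bilinear_form (fun u v => f (p.1 * u) (p.2 * v)).
  by split=> *; rewrite mul_linear_r ?fl ?fr.
have bg (y0 : H) : bilinear_form (fun u v =>
    \sum_(q <- oalg_comul y0) f (u * q.1) (v * q.2)).
  split=> *; rewrite -sum_lin; apply: eq_bigr => q _.
    by rewrite (form_linear_r (bfl q)).
  by rewrite (form_linear_l (bfl q)).
have lf := comul_form_scalar bf.
move: x; apply: scalar_cls_ext => [a u v||w].
- by rewrite mul_linear_l lf.
- exact: (comul_form_scalar (bg y)).
move: y; apply: scalar_cls_ext => [a u v|a u v|z].
- by rewrite mul_linear_r lf.
- rewrite -sum_lin; apply: eq_bigr => p _.
  exact: (comul_form_scalar (bfr p)).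
rewrite -cls_cat (comul_form_cls bf) (comul_form_cls (bg _)).
under [RHS]eq_bigr do rewrite (comul_form_cls (bfr (_, _))).
rewrite (big_splits_cat (fun u v => f (cls u) (cls v))).
by apply: eq_bigr => p _; apply: eq_bigr => q _; rewrite !cls_cat.
Qed.

Lemma oalg_counit_mul x y :
  oalg_counit (x * y) = oalg_counit x * oalg_counit y.
Proof.
have lc := oalg_counit_scalar.
move: x; apply: scalar_cls_ext => [a u v|a u v|w].
- by rewrite mul_linear_l lc.
- by rewrite lc mulrDl mulrA.
move: y; apply: scalar_cls_ext => [a u v|a u v|z].
- by rewrite mul_linear_r lc.
- by rewrite lc mulrDr mulrCA.
by rewrite -cls_cat !oalg_counit_cls counit_word_cat.
Qed.

Lemma eval_counit_mulr a h :
  eval (fun w => counit_word w * a) h = oalg_counit h * a.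
Proof.
rewrite /oalg_counit /eval /eval_formal mulr_suml.
by apply: eq_bigr => t _; rewrite mulrA.
Qed.

Lemma oalg_antipode_left h :
  \sum_(p <- oalg_comul h) oalg_antipode p.1 * p.2 = oalg_counit h *: 1.
Proof.
apply: eval_inj => phi bal; rewrite eval_sum // evalZ // eval1 //.
rewrite (comul_formE (f := fun u v => eval phi (oalg_antipode u * v))).
  rewrite -eval_counit_mulr; apply: eval_ext => w.
  rewrite -(splits_antipode_left sK c_neq0 w bal); apply: eq_bigr => p _.
  by rewrite oalg_antipode_cls -scalerAl -cls_cat evalZ // eval_cls.
split=> [u a v v'|v a u u']; first by rewrite mul_linear_r (eval_scalar bal).
by rewrite oalg_antipode_linear mul_linear_l (eval_scalar bal).
Qed.

Lemma oalg_antipode_right h :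
  \sum_(p <- oalg_comul h) p.1 * oalg_antipode p.2 = oalg_counit h *: 1.
Proof.
apply: eval_inj => phi bal; rewrite eval_sum // evalZ // eval1 //.
rewrite (comul_formE (f := fun u v => eval phi (u * oalg_antipode v))).
  rewrite -eval_counit_mulr; apply: eval_ext => w.
  rewrite -(splits_antipode_right sK c_neq0 w bal); apply: eq_bigr => p _.
  by rewrite oalg_antipode_cls -scalerAr -cls_cat evalZ // eval_cls.
split=> [u a v v'|v a u u']; last by rewrite mul_linear_l (eval_scalar bal).
by rewrite oalg_antipode_linear mul_linear_r (eval_scalar bal).
Qed.

Lemma oalg_is_hopf : is_hopf oalg_hopf.
Proof.
split.
- exact: oalg_comul_linear.
- exact: oalg_coassoc.
- exact: oalg_counit_scalar.
- exact: oalg_counit_left.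
- exact: oalg_counit_right.
- by move=> f bf; rewrite -cls_nil (comul_form_cls bf) !big_seq1.
- exact: oalg_comul_mul.
- exact: (oalg_counit_cls [::]).
- exact: oalg_counit_mul.
- exact: oalg_antipode_linear.
- exact: oalg_antipode_left.
- exact: oalg_antipode_right.
Qed.

Hypothesis char0 : [pchar k] =i pred0.
Hypothesis loop2 : \sum_a c a / c (s a) = 2%:R.
Variable i0 : I.
Local Notation haar := (haar s c i0).

Lemma oalg_cosemisimple : cosemisimple oalg_hopf.
Proof.
have bal_haar := haar_balanced char0 sK c_neq0 loop2 i0.
apply: (@cosemisimple_of_integral k H oalg_hopf oalg_is_hopf (eval haar)).
- exact: eval_scalar.
- by rewrite -cls_nil eval_cls.
move=> L lL h g /=.
have lS := oalg_antipode_linear.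
have bfl g' : bilinear_form (fun u v : H => L u * eval haar (v * oalg_antipode g')).
  split=> [u a v v'|v a u u']; last by rewrite lL mulrDl mulrA.
  by rewrite mul_linear_l (eval_scalar bal_haar) mulrDr mulrCA.
have bfr h' : bilinear_form (fun u v : H => eval haar (h' * oalg_antipode u) * L v).
  split=> [u a v v'|v a u u']; first by rewrite lL mulrDr mulrCA.
  by rewrite lS mul_linear_r (eval_scalar bal_haar) mulrDl mulrA.
move: h; apply: scalar_cls_ext => [|a u v|w].
- exact: (comul_form_scalar (bfl g)).
- rewrite -sum_lin; apply: eq_bigr => q _.
  by rewrite mul_linear_l (eval_scalar bal_haar) mulrDl mulrA.
move: g; apply: scalar_cls_ext => [a u v||z].
- rewrite -sum_lin; apply: eq_bigr => q _.
  by rewrite lS mul_linear_r (eval_scalar bal_haar) mulrDr mulrCA.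
- exact: (comul_form_scalar (bfr (cls w))).
rewrite (comul_form_cls (bfl _)) (comul_form_cls (bfr _)).
have haar_anti u v : eval haar (cls u * oalg_antipode (cls v)) =
    anti_coef v * haar (u ++ anti_word v).
  by rewrite oalg_antipode_cls -scalerAr -cls_cat evalZ // eval_cls.
under eq_bigr do rewrite haar_anti; under [RHS]eq_bigr do rewrite haar_anti.
apply: (integral_antipode sK c_neq0 _ w z (balanced_functional lL)).
by move=> phi y; exact: haar_invariant.
Qed.

(** * The order of the antipode *)

Definition asym (a : I) : k := c a / c (s a).

Lemma anti_wordK : involutive anti_word.
Proof.
move=> w; rewrite /anti_word map_rev revK -map_comp map_id_in // => -[i j] _ /=.
by rewrite /anti_letter /= !sK.
Qed.

Lemma antipode_sqr_cls w : iter 2 oalg_antipode (cls w) =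
  (\prod_(x <- w) (asym x.1 / asym x.2)) *: cls w.
Proof.
rewrite /= oalg_antipode_cls (linear_mapZ oalg_antipode_linear) oalg_antipode_cls.
rewrite anti_wordK scalerA; congr (_ *: _).
rewrite /anti_coef /anti_word (perm_big _ (permEl (perm_rev _))) big_map -big_split.
by apply: eq_bigr => x _; rewrite /= /asym; field; rewrite !c_neq0.
Qed.

Lemma iter_antipode_linear n : linear (iter n oalg_antipode).
Proof. by elim: n => [|n IHn] a x y //=; rewrite IHn oalg_antipode_linear. Qed.

Lemma antipode_even_cls n w : iter (2 * n) oalg_antipode (cls w) =
  (\prod_(x <- w) (asym x.1 / asym x.2)) ^+ n *: cls w.
Proof.
elim: n => [|n IHn]; first by rewrite expr0 scale1r.
rewrite mulnS iterD IHn (linear_mapZ (iter_antipode_linear 2)) antipode_sqr_cls.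
by rewrite scalerA exprSr.
Qed.

(** The character [x_ij |-> t_i] if [i = j] and 0 otherwise: a diagonal matrix that preserves [E]
    when [t a * t (s a) = 1]. *)
Definition torus_word (t : I -> k) w : k := counit_word w * \prod_(x <- w) t x.1.

Lemma balanced_torus t : (forall a, t a * t (s a) = 1) -> balanced (torus_word t).
Proof.
move=> tV; have [bal1 bal2] := balanced_counit s c.
have prod_mid x y w1 w2 : \prod_(l <- w1 ++ x :: y :: w2) t l.1 =
    t x.1 * t y.1 * \prod_(l <- w1 ++ w2) t l.1.
  by rewrite !big_cat !big_cons /=; ring.
split=> w1 w2 i j; rewrite /torus_word.
  under [LHS]eq_bigr do rewrite prod_mid mulrA /=.
  rewrite -mulr_suml bal1 /=.
  by case: eqP => [->|_]; rewrite ?tV ?mul0r // mul1r mulrA.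
under [LHS]eq_bigr do rewrite prod_mid /= tV mul1r mulrA.
by rewrite -mulr_suml bal2 mulrA.
Qed.

Lemma iter_antipode_diag n a :
  iter n oalg_antipode (cls [:: (a, a)]) = cls [:: (iter n s a, iter n s a)].
Proof.
elim: n => //= n ->; rewrite oalg_antipode_cls /anti_coef big_seq1 /=.
by rewrite divff // scale1r.
Qed.

Lemma antipode_odd_neq n a : odd n -> s a != a ->
  iter n oalg_antipode (cls [:: (a, a)]) <> cls [:: (a, a)].
Proof.
move=> odd_n sa; rewrite iter_antipode_diag.
have -> : iter n s a = s a.
  rewrite -(odd_double_half n) odd_n add1n /=; congr s.
  by elim: n./2 => //= m IHm; rewrite IHm sK.
(* A character with value 2 at [x_aa] and 1/2 at its image; these differ because [2 * 2 - 1 = 3] is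
   nonzero in characteristic zero. *)
pose t b : k := if b == a then 2%:R else if b == s a then 2%:R^-1 else 1.
have two_neq0 : 2%:R != 0 :> k by have /pcharf0P -> := char0.
have /balanced_torus bal b : t b * t (s b) = 1.
  rewrite /t (inj_eq (can_inj sK)) (can2_eq sK sK).
  have [->|ba] := eqVneq b a; first by rewrite eq_sym (negPf sa) divff.
  by have [_|_] := eqVneq b (s a); rewrite ?mulVf ?mulr1.
move/(congr1 (eval (torus_word t))); rewrite !eval_cls //.
rewrite /torus_word !big_seq1 !counit_word_cons !eqxx !mul1r /t /=.
rewrite eqxx (negPf sa) eqxx => half_eq2.
have := mulfV two_neq0; rewrite half_eq2 -natrM => /eqP.
by rewrite -subr_eq0 -[1]/(1%:R) -natrB //; have /pcharf0P -> := char0.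
Qed.

Lemma cls_letter_neq0 a b : cls [:: (a, b)] != 0.
Proof.
have bal := balanced_cat_r [:: (s a, s b)] (haar_balanced char0 sK c_neq0 loop2 i0).
apply/eqP => /(congr1 (eval (fun z => haar (z ++ [:: (s a, s b)])))).
rewrite eval_cls // [RHS]eval0 // => /eqP.
by apply/negP; apply: haar_hyperbolic.
Qed.

Lemma oalg_antipode_order m a : (0 < m)%N -> s a != a ->
  (forall b, asym b ^+ m = 1) ->
  (forall n, (0 < n < m)%N -> exists b b', (asym b / asym b') ^+ n != 1) ->
  antipode_order_is oalg_hopf (2 * m).
Proof.
move=> m_gt0 sa asym_m asym_n; split; first by rewrite muln_gt0.
split=> [|n n_lt] /=.
  apply: (linear_cls_ext (iter_antipode_linear _) (fun _ _ _ => erefl)) => w.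
  rewrite antipode_even_cls -prodrXl big1 ?scale1r // => x _.
  by rewrite expr_div_n !asym_m divr1.
have [odd_n|even_n] := boolP (odd n).
  by move/(_ (cls [:: (a, a)])); exact: antipode_odd_neq.
have nE : n = (2 * n./2)%N by rewrite mul2n -[LHS]odd_double_half (negPf even_n).
have [|b [b' bb']] := asym_n n./2.
  by move: n_lt; rewrite {1 2}nE ltn_pmul2l // muln_gt0.
(* The generator [x_bb'] is a nonzero eigenvector of [S^n] with eigenvalue different from 1. *)
move/(_ (cls [:: (b, b')])); rewrite nE antipode_even_cls big_seq1 /= => /eqP.
rewrite -subr_eq0 -{2}[cls _]scale1r -scalerBl scaler_eq0 subr_eq0 (negPf bb').
by rewrite (negPf (cls_letter_neq0 _ _)).
Qed.

End HopfStructure.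

(** * Roots of unity and the choice of the bilinear form *)

Lemma exists_primitive_root (k : closedFieldType) (m : nat) :
  [pchar k] =i pred0 -> (0 < m)%N -> exists z : k, m.-primitive_root z.
Proof.
move=> /pcharf0P char0 m_gt0.
have [rs rsE] := closed_field_poly_normal ('X^m - 1 : {poly k}).
have mon : lead_coef ('X^m - 1 : {poly k}) = 1 by exact/eqP/monic_Xn_sub_1.
rewrite mon scale1r in rsE.
(* Characteristic zero makes [X^m - 1] separable, hence it has [m] distinct roots, enough for one of
   them to be primitive. *)
have uniq_rs : uniq rs.
  rewrite -separable_prod_XsubC -rsE separable_Xn_sub_1 // char0.
  by rewrite -lt0n.
have size_rs : size rs = m.
  by have := size_XnsubC (1 : k) m_gt0; rewrite rsE size_prod_XsubC => -[].
have /hasP[z _ zP] : has m.-primitive_root rs.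
  apply: has_prim_root => //; last by rewrite size_rs.
  apply/allP => x x_rs; apply/unity_rootP; apply/eqP; rewrite -subr_eq0.
  have : root ('X^m - 1) x by rewrite rsE root_prod_XsubC.
  by rewrite rootE !hornerE.
by exists z.
Qed.

Lemma sum_root_powers (k : fieldType) (y : k) (m : nat) :
  y ^+ m = 1 -> (m != 1)%N -> y != 1 -> \sum_(j < m.+1) y ^+ j = 1.
Proof.
move=> ym m1 y1; rewrite big_ord_recr /= ym.
have /eqP := subrX1 y m; rewrite ym subrr eq_sym mulf_eq0 subr_eq0 (negPf y1) /=.
by move/eqP->; rewrite add0r.
Qed.

Theorem theorem1 (m : nat) (k : closedFieldType) :
  (1 <= m)%N -> [pchar k] =i pred0 ->
  exists (H : algType k) (D : hopf_data H),
    is_hopf D /\ cosemisimple D /\ antipode_order_is D (2 * m).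
Proof.
move=> m_gt0 char0; have [z z_prim] := exists_primitive_root char0 m_gt0.
have zm : z ^+ m = 1 by exact: prim_expr_order.
have z_neq0 : z != 0.
  by apply/eqP => z0; move/eqP: zm; rewrite z0 expr0n eqn0Ngt m_gt0 eq_sym oner_eq0.
(* The eigenvalues of [S^2] come from [c], and [c] must satisfy the loop
   condition: adjoining [z ^+ m = 1] to the [m] powers of [z], whose sum
   vanishes for [m > 1], makes both halves of the loop sum equal to [1]. *)
pose d := if m == 1%N then 0%N else m.
have z1 : (m != 1)%N -> z != 1.
  by rewrite -[z]expr1 -(prim_order_dvd z_prim) dvdn1.
have sum_pow (y : k) : y ^+ m = 1 -> ((m != 1)%N -> y != 1) -> \sum_(j < d.+1) y ^+ j = 1.
  rewrite /d; have [_ _ _|m1 ym /(_ isT) y1] := eqVneq m 1%N.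
    by rewrite big_ord1.
  exact: sum_root_powers.
(* Two copies of the index set, swapped by [s]: the asymmetry is [z ^+ j] on the [false] copy and
   its inverse on the [true] copy, so each copy contributes 1 to the loop value. *)
pose s (x : bool * 'I_d.+1) := (~~ x.1, x.2).
pose c (x : bool * 'I_d.+1) : k := if x.1 then 1 else z ^+ x.2.
have sK : involutive s by move=> [b j]; rewrite /s /= negbK.
have c_neq0 x : c x != 0 by rewrite /c; case: x.1; rewrite ?oner_neq0 ?expf_neq0.
have loop2 : \sum_x c x / c (s x) = 2%:R.
  rewrite -(pair_bigA _ (fun b j => c (b, j) / c (s (b, j)))) big_bool /c /s /=.
  under eq_bigr do rewrite div1r -exprVn.
  under [X in _ + X]eq_bigr do rewrite divr1.
  by rewrite !sum_pow // ?invr_eq1 // exprVn zm invr1.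
exists (orthogonal_algebra s c), (oalg_hopf s c); split; last split.
- exact: oalg_is_hopf.
- exact: (oalg_cosemisimple sK c_neq0 char0 loop2 (true, ord0)).
apply: (@oalg_antipode_order k _ s c sK c_neq0 char0 loop2 (true, ord0) m (true, ord0)).
- by [].
- by [].
- move=> [b j]; rewrite /asym /c /s /=; case: b.
    by rewrite div1r exprVn exprAC zm expr1n invr1.
  by rewrite divr1 exprAC zm expr1n.
move=> n /andP[n_gt0 lt_nm].
have m1 : (m == 1%N) = false by apply/gtn_eqF/(leq_trans _ lt_nm).
have lt1d : (1 < d.+1)%N by rewrite /d m1.
(* The asymmetries at indices 1 and 0 are [z] and [1], with ratio [z] of order exactly [m]; index 1
   is available because [0 < n < m] forces [m > 1]. *)
exists (false, Ordinal lt1d), (false, ord0).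
rewrite /asym /c /s /= !divr1 expr1 -(prim_order_dvd z_prim).
by apply/negP => /(dvdn_leq n_gt0); rewrite leqNgt lt_nm.
Qed.
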